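(* There exist universal constants $a_1,a_2>0$ such that the following holds. Let $n\ge1$ be an integer, $\gamma\in(0,\frac12)$, and let $\boldsymbol p=(p(j))_{j\ge1}$ be a sequence with $p(j)\in[0,\frac12]$ and $p(j)\ge p(j+1)$ for all $j\ge1$. (i) If there exists $j\ge1$ with $p(j)\ge\frac{\gamma}{2nj}$, then $$\mathbb P\left(\|\hat{\boldsymbol p}_n-\boldsymbol p\|_\infty\ge a_1\sup_{j\ge1}\phi_{\frac j\gamma,p(j)}(n)\right)\le\gamma$$ and $$\mathbb P\left(\|\hat{\boldsymbol p}_n-\boldsymbol p\|_\infty\vee\frac1n\le a_2\sup_{j\ge1}\phi_{\frac{j}{\ln(1/\gamma)},p(j)}(n)\right)\le\gamma.$$ (ii) If $p(j)\le\frac{\gamma}{2nj}$ for all $j\ge1$, then $$\mathbb P\left(\sup_{j\ge1}\hat p_n(j)\ge\frac2n\right)\le\gamma\qquad\text{and}\qquad\mathbb P\left(\sup_{j\ge1}\hat p_n(j)=\frac1n\right)\asymp1\wedge n\sum_{j\ge1}p(j),$$ with universal constants in $\asymp$.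
   Context: Notation: $a\vee b=\max(a,b)$, $a\wedge b=\min(a,b)$; $A\asymp B$ means $cB\le A\le CB$ for universal constants $0<c\le C$. $\hat{\boldsymbol p}_n=\frac1n\sum_{i=1}^nX_i$ where $X_1,\dots,X_n$ are i.i.d. samples from the product distribution on $\{0,1\}^{\mathbb N}$ whose coordinates are independent Bernoulli variables with parameters $p(j)$; $\|\hat{\boldsymbol p}_n-\boldsymbol p\|_\infty=\sup_j|\hat p_n(j)-p(j)|$. For integer $n\ge1$, real $J\ge1$ and $q\in(0,\frac12]$ define $$\phi_{J,q}(n)=\begin{cases}1 & n\le\frac{\ln(J+1)}{\ln(1/q)},\\ \frac{\ln(J+1)}{n\ln\frac{\ln(J+1)}{nq}} & \frac{\ln(J+1)}{\ln(1/q)}\le n\le\frac{\ln(J+1)}{eq},\\ \sqrt{\frac{q\ln(J+1)}{n}} & n\ge\frac{\ln(J+1)}{eq},\end{cases}$$ where the first applicable case is used if the conditions overlap. For $J\in(0,1)$ define $\phi_{J,q}(n)=e^{-1/J}\sqrt{q/n}$. By convention $\phi_{J,0}(n)=0$. *)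

(* Defs.v *)
From HB Require Import structures.
From mathcomp Require Import all_boot all_order all_algebra.
From mathcomp Require Import all_classical all_reals all_analysis.
Set Implicit Arguments.
Unset Strict Implicit.
Unset Printing Implicit Defensive.
Import Order.TTheory GRing.Theory Num.Theory.
Import numFieldNormedType.Exports.
Local Open Scope classical_set_scope.
Local Open Scope ring_scope.

(* Sequences indexed by j >= 1 are 0-indexed throughout:
   index j : nat stands for the mathematical index j.+1. *)

Definition cylinders : set (set (nat -> bool)) :=
  [set A | exists j b, A = [set x | x j = b]].

(* {0,1}^N with the product sigma-algebra *)
Notation binseq := (g_sigma_algebraType cylinders).

Definition coord (j : nat) (x : binseq) : bool := x j.

Definition independent (d d' : measure_display) (T : measurableType d)
    (T' : measurableType d') (R : realType) (P : probability T R)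
    (I : eqType) (X : I -> T -> T') : Prop :=
  forall (s : seq I) (A : I -> set T'), uniq s ->
    (forall i, measurable (A i)) ->
    P (\bigcap_(i in [set` s]) (X i @^-1` A i)) =
      (\prod_(i <- s) P (X i @^-1` A i))%E.

Definition product_bernoulli (R : realType) (p : nat -> R)
    (mu : probability binseq R) : Prop :=
  independent mu coord /\
  forall j, pushforward mu (coord j) = bernoulli_prob (p j).

Definition iid_sample (d d' : measure_display) (T : measurableType d)
    (T' : measurableType d') (R : realType) (P : probability T R)
    (mu : probability T' R) (n : nat) (X : 'I_n -> {RV P >-> T'}) : Prop :=
  independent P (fun i => X i : T -> T') /\
  forall i A, measurable A -> distribution P (X i) A = mu A.

Definition emp_mean (T : Type) (R : realType) (n : nat)
    (X : 'I_n -> T -> binseq) (t : T) (j : nat) : R :=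
  (\sum_(i < n) (coord j (X i t))%:R) / n%:R.

(* Suprema are taken in the extended reals, so that no boundedness proof is
   needed for them to be meaningful. *)
Definition sup_seq (R : realType) (u : nat -> R) : \bar R :=
  ereal_sup (range (fun j => (u j)%:E)).

(* Meaningful for J > 0, 0 <= q <= 1/2 and n >= 1; each 'else' encodes the
   lower bound on n of the next case. *)
Definition phi (R : realType) (J q : R) (n : nat) : R :=
  let L := ln (J + 1) in
  if q == 0 then 0
  else if J < 1 then expR (- J^-1) * Num.sqrt (q / n%:R)
  else if n%:R <= L / ln (q^-1) then 1
  else if n%:R <= L / (expR 1 * q) then L / (n%:R * ln (L / (n%:R * q)))
  else Num.sqrt (q * L / n%:R).

(* Main.v *)
Require Import Defs.
From HB Require Import structures.
From mathcomp Require Import all_boot all_order all_algebra.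
From mathcomp Require Import all_classical all_reals all_analysis.
From mathcomp Require Import measurable_realfun ring lra.
Import Order.TTheory GRing.Theory Num.Theory.
Import numFieldNormedType.Exports.
Local Open Scope classical_set_scope.
Local Open Scope ring_scope.
Set Implicit Arguments.
Unset Strict Implicit.
Unset Printing Implicit Defensive.

(* Under the product law the numbers of ones in distinct coordinates are
   independent binomial variables, so every event reduces to binomial tails.

   (i) With L = ln (J + 1) and x = L / (nq), Chernoff's bound with parameter
   ln x (if x >= e) or sqrt x / 6 (if x <= e) shows that a deviation
   20 phi_(J,q)(n) has probability at most 2 (J + 1)^-3, which is summable
   over j for J = j / gamma. Conversely, choose j almost attaining the supremum
   and set J = j / ln (1 / gamma): each coordinate i <= j stays within
   c phi_(J,p(j))(n) of its mean with probability at most exp (-1 / J), and the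
   product over these j coordinates is at most gamma. This small-ball estimate
   follows from the bound 4 / sqrt (np) on binomial probabilities when J is
   bounded, and for large J from lower bounds on the upper tail: a single
   binomial term if x >= e, and the Paley-Zygmund inequality if x <= e.

   (ii) P (Bin >= 2) <= (np)^2 / 2 makes counts above 1 negligible, while
   P (some count >= 1) is comparable to the minimum of 1 and n sum_j p(j). *)

(** * Exponential and binomial estimates *)

Lemma expR_ge1Dx2 (R : realType) (x : R) :
  0 <= x -> 1 + x + x ^+ 2 / 2 <= expR x.
Proof.
move=> x0.
have nd : nondecreasing_seq (series (exp_coeff x)).
  by apply/nondecreasing_series => i _ _; exact: exp_coeff_ge0.
have := nondecreasing_cvgn_le nd (is_cvg_series_exp_coeff x) 3%N.
rewrite seriesEnat /= !big_nat_recr //= big_nil /exp_coeff /=.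
by rewrite !factS fact0 !muln1 expr0 expr1 add0r !divr1.
Qed.

(** Squaring [expR (- (y / 2)) >= 1 - y / 2 >= 0] bounds [expR y] by (1 - y/2)^-2, and the claim
    becomes polynomial. Negative [y] matter: the lower tail takes a negative Chernoff parameter. *)
Lemma expR_le_quad (R : realType) (y : R) :
  y <= 3^-1 -> expR y <= 1 + y + y ^+ 2.
Proof.
move=> y13.
have h : 1 - y / 2 <= expR (- (y / 2)) by exact: expR_ge1Dx.
have e : expR y * expR (- (y / 2)) ^+ 2 = 1.
  by rewrite -expRM_natr -expRD -[RHS]expR0; congr expR; lra.
have h2 : (1 - y / 2) ^+ 2 <= expR (- (y / 2)) ^+ 2.
  by apply: lerXn2r; rewrite ?nnegrE ?expR_ge0//; lra.
have e0 := expR_gt0 (- (y / 2)).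
rewrite -(ler_pM2r (exprn_gt0 2 e0)) e.
apply: (@le_trans _ _ ((1 + y + y ^+ 2) * (1 - y / 2) ^+ 2)); last first.
  apply: ler_wpM2l => //; nra.
have -> : (1 + y + y ^+ 2) * (1 - y / 2) ^+ 2 = 1 + (y / 2) ^+ 2 * (1 - 3 * y + y ^+ 2).
  by field.
rewrite lerDl; apply: mulr_ge0; [exact: sqr_ge0|].
have := sqr_ge0 y; lra.
Qed.

(** The same squaring argument on a shorter interval. The constant 4/5 in place of 1 makes room for
    the term p lam^2 / 20 in [expR_lower_cumulant]. *)
Lemma expR_le_quad_small (R : realType) (z : R) :
  0 <= z <= 11^-1 -> expR z <= 1 + z + 4 / 5 * z ^+ 2.
Proof.
move=> /andP[z0 z1].
have h : 1 - z / 2 <= expR (- (z / 2)) by exact: expR_ge1Dx.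
have e : expR z * expR (- (z / 2)) ^+ 2 = 1.
  by rewrite -expRM_natr -expRD -[RHS]expR0; congr expR; lra.
have h2 : (1 - z / 2) ^+ 2 <= expR (- (z / 2)) ^+ 2.
  by apply: lerXn2r; rewrite ?nnegrE ?expR_ge0//; lra.
have e0 := expR_gt0 (- (z / 2)).
rewrite -(ler_pM2r (exprn_gt0 2 e0)) e.
apply: (@le_trans _ _ ((1 + z + 4 / 5 * z ^+ 2) * (1 - z / 2) ^+ 2)); last first.
  apply: ler_wpM2l => //; nra.
have -> : (1 + z + 4 / 5 * z ^+ 2) * (1 - z / 2) ^+ 2 =
   1 + z ^+ 2 * (20^-1 - 11 / 20 * z + 5^-1 * z ^+ 2).
  by field.
rewrite lerDl; apply: mulr_ge0; [exact: sqr_ge0|].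
have := sqr_ge0 z; lra.
Qed.

Lemma expR1_le3 (R : realType) : expR 1 <= 3 :> R.
Proof.
(* The exponent 8 suffices because 3 (7/8)^8 >= 1. *)
have h : 1 - 8^-1 <= expR (- 8^-1) :> R by exact: expR_ge1Dx.
have e : expR 1 * expR (- 8^-1) ^+ 8 = 1 :> R.
  by rewrite -expRM_natr -expRD -[RHS]expR0; congr expR; lra.
have h2 : (1 - 8^-1) ^+ 8 <= expR (- 8^-1) ^+ 8 :> R.
  by apply: lerXn2r; rewrite ?nnegrE ?expR_ge0//; lra.
rewrite -(ler_pM2r (exprn_gt0 8 (expR_gt0 (- 8^-1)))) e.
apply: (le_trans _ (ler_wpM2l _ h2)); lra.
Qed.

Lemma expR1_ge52 (R : realType) : 5 / 2 <= expR 1 :> R.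
Proof. have := @expR_ge1Dx2 R 1 ler01; lra. Qed.

(** * Probabilities of binomial events and Chernoff's bound *)

Definition bin_prob (R : realType) (n : nat) (p : R) (E : pred nat) : R :=
  \sum_(k < n.+1 | E k) binomial_pmf n p k.

Lemma binomial_pmfE (R : realType) n (p : R) k :
  binomial_pmf n p k = 'C(n, k)%:R * (p ^+ k * (1 - p) ^+ (n - k)).
Proof. by rewrite /binomial_pmf mulr_natl. Qed.

(** The binomial theorem; [a = 1] gives the total mass and [a = expR lam] the moment generating
    function. *)
Lemma binomial_pmf_mgf (R : realType) n (p a : R) :
  \sum_(k < n.+1) binomial_pmf n p k * a ^+ k = (1 - p + p * a) ^+ n.
Proof.
rewrite exprDn; apply: eq_bigr => k _.
by rewrite exprMn binomial_pmfE -[RHS]mulr_natl; ring.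
Qed.

Section BinProb.
Variables (R : realType) (n : nat) (p : R).
Hypothesis p01 : 0 <= p <= 1.
Let b := binomial_pmf n p.

Let b0 k : 0 <= b k. Proof. exact: binomial_pmf_ge0. Qed.

Lemma bin_probT : bin_prob n p predT = 1.
Proof.
have := binomial_pmf_mgf n p 1.
under eq_bigr do rewrite expr1n mulr1.
by rewrite mulr1 subrK expr1n.
Qed.

Lemma bin_prob_ge0 E : 0 <= bin_prob n p E.
Proof. by apply: sumr_ge0 => k _; exact: b0. Qed.

Lemma le_bin_prob (E F : pred nat) : {subset E <= F} ->
  bin_prob n p E <= bin_prob n p F.
Proof.
move=> EF; rewrite /bin_prob [leLHS]big_mkcond [leRHS]big_mkcond /=.
apply: ler_sum => k _; have := EF k; rewrite !unfold_in.
by case: (E k) => [->//|_]; case: (F k) => //; exact: b0.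
Qed.

Lemma bin_probC E : bin_prob n p (predC E) = 1 - bin_prob n p E.
Proof.
apply/esym/eqP; rewrite subr_eq -bin_probT /bin_prob addrC.
by rewrite (bigID (fun k : 'I_n.+1 => E k)) /=.
Qed.

Lemma bin_prob_markov (f : nat -> R) (E : pred nat) :
  (forall k, 0 <= f k) -> (forall k, E k -> 1 <= f k) ->
  bin_prob n p E <= \sum_(k < n.+1) b k * f k.
Proof.
move=> f0 fE; rewrite /bin_prob big_mkcond /=; apply: ler_sum => k _.
case: ifP => [/fE f1|_]; last by rewrite mulr_ge0.
by rewrite ler_peMr.
Qed.

Lemma binomial_pmf_expR lam B :
  \sum_(k < n.+1) b k * expR (lam * (k%:R - n%:R * p) - B) =
  expR (- B - lam * (n%:R * p)) * (1 - p + p * expR lam) ^+ n.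
Proof.
rewrite -binomial_pmf_mgf big_distrr /=; apply: eq_bigr => k _.
rewrite mulrCA -expRM_natr -expRD; congr (_ * expR _); ring.
Qed.

(** Comparison with the Poisson moment generating function, by 1 + y <= exp y in each Bernoulli
    factor. *)
Lemma bin_mgf_le lam : (1 - p + p * expR lam) ^+ n <=
  expR (n%:R * p * (expR lam - 1)).
Proof.
rewrite -mulrA expRM_natl; apply: lerXn2r; rewrite ?nnegrE ?expR_ge0//.
  by case/andP: p01 => p0 p1; rewrite addr_ge0 ?subr_ge0// mulr_ge0 ?expR_ge0.
by apply: le_trans (expR_ge1Dx _); lra.
Qed.

(** Markov's inequality for exp (lam (k - np) - B). The sign of [lam] is free, so that one statement
    serves both tails. *)
Lemma bin_prob_chernoff lam B (E : pred nat) :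
  (forall k : nat, E k -> B <= lam * (k%:R - n%:R * p)) ->
  bin_prob n p E <= expR (n%:R * p * (expR lam - 1 - lam) - B).
Proof.
move=> EB; apply: (le_trans (@bin_prob_markov
    (fun k => expR (lam * (k%:R - n%:R * p) - B)) E _ _)).
- by move=> k; exact: expR_ge0.
- by move=> k /EB h; rewrite -[leLHS]expR0 ler_expR subr_ge0.
rewrite binomial_pmf_expR; apply: (le_trans (ler_wpM2l _ (bin_mgf_le lam))).
  exact: expR_ge0.
by rewrite -expRD ler_expR; lra.
Qed.

End BinProb.

(** * Concentration function of the binomial law *)

Lemma binomial_pmf_succ (R : realType) n (p : R) m : (m < n)%N ->
  binomial_pmf n p m * ((n - m)%:R * p) =
  binomial_pmf n p m.+1 * (m.+1%:R * (1 - p)).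
Proof.
move=> mn; rewrite !binomial_pmfE -(subnSK mn) !exprS.
have h : m.+1%:R * 'C(n, m.+1)%:R = (n - m)%:R * 'C(n, m)%:R :> R.
  by rewrite -!natrM mul_bin_left.
rewrite (subnSK mn).
transitivity ((n - m)%:R * 'C(n, m)%:R *
  (p * p ^+ m * ((1 - p) * (1 - p) ^+ (n - m.+1)))); first by ring.
by rewrite -h; ring.
Qed.

Lemma binomial_pmf_sym (R : realType) n (p : R) k : (k <= n)%N ->
  binomial_pmf n p k = binomial_pmf n (1 - p) (n - k).
Proof.
move=> kn; rewrite !binomial_pmfE bin_sub// subKn// opprB addrCA subrr addr0.
by rewrite [p ^+ k * _]mulrC.
Qed.

Section PmfBound.
Variables (R : realType) (n : nat) (p : R).
Hypothesis p01 : 0 < p < 1.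
Let b := binomial_pmf n p.
Let D := n.+1%:R * p * (1 - p).

Let b0 k : 0 <= b k.
Proof. by apply: binomial_pmf_ge0; case/andP: p01 => /ltW-> /ltW->. Qed.

Let D0 : 0 < D.
Proof. by case/andP: p01 => p0 p1; rewrite !mulr_gt0// subr_gt0. Qed.

(** The ratio b m / b (m + 1) = (m + 1)(1 - p) / ((n - m) p) increases with m, so it is enough to
    bound it where m + 1 equals (n + 1) p - s; there the claim reduces to dropping the term s^2 p /
    D. *)
Lemma binomial_pmf_pred_ge m s : (m < n)%N -> 0 <= s ->
  n.+1%:R * p - s <= m.+1%:R -> b m.+1 * (1 - s / D) <= b m.
Proof.
case/andP: p01 => p0 p1 mn s0 sm.
have [sD|sD] := leP (1 - s / D) 0.
  by apply: le_trans (b0 m); rewrite mulr_ge0_le0.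
have nm0 : 0 < (n - m)%:R * p by rewrite mulr_gt0// ltr0n subn_gt0.
rewrite -(ler_pM2r nm0) binomial_pmf_succ// -mulrA ler_wpM2l//.
rewrite natrB; last exact: ltnW.
have -> : n%:R - m%:R = n.+1%:R - m.+1%:R :> R by rewrite -!natr1; ring.
set v := m.+1%:R in sm *; set N := n.+1%:R in sm *.
have vN : v < N by rewrite ltr_nat.
have e : N * p * (1 - p) = D by [].
have h1 : (1 - s / D) * ((N - (N * p - s)) * p) <= (N * p - s) * (1 - p).
  have -> : (1 - s / D) * ((N - (N * p - s)) * p) =
     (N * p - s) * (1 - p) - s ^+ 2 * p / D.
    have -> : (N - (N * p - s)) * p = D + s * p by rewrite -e; ring.
    have -> : (N * p - s) * (1 - p) = D - s * (1 - p) by rewrite -e; ring.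
    by field; rewrite gt_eqF.
  by rewrite gerBl divr_ge0 ?(ltW D0)// mulr_ge0 ?sqr_ge0// ltW.
apply: (le_trans _ (le_trans h1 _)).
  rewrite ler_wpM2l ?(ltW sD)// ler_wpM2r ?(ltW p0)//; lra.
by rewrite ler_wpM2r ?subr_ge0 ?(ltW p1).
Qed.

(** Iterates the one-step bound with s = i + 1 <= h and replaces the product of the factors by 1 - i
    h / D. The conclusion [i <= k] is proved along with it, since [k - i] is a truncated
    subtraction. *)
Lemma binomial_pmf_near (k h i : nat) : (k <= n)%N ->
  n.+1%:R * p - 1 <= k%:R -> h%:R ^+ 2 <= D / 2 -> (i <= h)%N ->
  (i <= k)%N /\ b k * (1 - i%:R * (h%:R / D)) <= b (k - i)%N.
Proof.
move=> kn kp hD; case/andP: (p01) => p0 p1.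
have hh : h%:R <= h%:R ^+ 2 :> R.
  by rewrite -natrX ler_nat; case: (h) => // h'; rewrite expnS leq_pmulr.
have hDr : h%:R < n.+1%:R * p.
  apply: (le_lt_trans hh); apply: (le_lt_trans hD).
  have : D <= n.+1%:R * p by rewrite /D ger_pMr ?mulr_gt0//; lra.
  by have := D0; lra.
elim: i => [|i IH] ih; first by split=> //; rewrite mul0r subr0 mulr1 subn0.
have [ik {}IH] := IH (ltnW ih).
have ihR : i.+1%:R <= h%:R :> R by rewrite ler_nat.
have ik' : (i < k)%N.
  by rewrite -(ltr_nat R); move: ihR; rewrite -natr1; lra.
split => //.
have e : (k - i)%N = (k - i.+1).+1 by rewrite subnSK.
have H : b (k - i)%N * (1 - i.+1%:R / D) <= b (k - i.+1)%N.
  rewrite e; apply: binomial_pmf_pred_ge.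
  - by rewrite -e; apply: leq_trans kn; rewrite leq_subr.
  - exact: ler0n.
  - by rewrite -e natrB// -natr1; lra.
apply: le_trans H.
have iD : 0 <= 1 - i.+1%:R / D.
  rewrite subr_ge0 ler_pdivrMr// mul1r; apply: (le_trans ihR).
  by have := D0; lra.
apply: (le_trans _ (ler_wpM2r iD IH)).
rewrite -mulrA ler_wpM2l//.
have Dv : 0 < D^-1 by rewrite invr_gt0.
rewrite -natr1 in ihR iD *.
have i0 : 0 <= i%:R :> R by exact: ler0n.
have a1 : i%:R * (h%:R / D) * ((i%:R + 1) / D) >= 0.
  by rewrite !mulr_ge0 ?ler0n ?(ltW Dv)// addr_ge0.
have a2 : (i%:R + 1) / D <= h%:R / D by rewrite ler_pM2r.
by move: a1 a2; set Y := h%:R / D; set Z := (_ + 1) / D; lra.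
Qed.

(* On the h + 1 points from k - h to k the probabilities stay above b k / 2:
   each step down loses at most a factor 1 - h / D, and h^2 <= D / 2. *)
Lemma binomial_pmf_right_le (k h : nat) : (k <= n)%N ->
  n.+1%:R * p - 1 <= k%:R -> h%:R ^+ 2 <= D / 2 -> b k * h.+1%:R <= 2.
Proof.
move=> kn kp hD.
have [hk _] := binomial_pmf_near kn kp hD (leqnn h).
have half i : (k - h <= i < k.+1)%N -> b k / 2 <= b i.
  move=> /andP[ki ik]; have [] := @binomial_pmf_near k h (k - i) kn kp hD _.
    by rewrite leq_subLR addnC -leq_subLR.
  move=> _; rewrite subKn//; apply: le_trans; rewrite ler_wpM2l//.
  have kih : (k - i)%:R <= h%:R :> R by rewrite ler_nat leq_subLR addnC -leq_subLR.
  have : (k - i)%:R * (h%:R / D) <= h%:R ^+ 2 / D.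
    by rewrite expr2 mulrA ler_pM2r ?invr_gt0// ler_wpM2r.
  have : h%:R ^+ 2 / D <= 2^-1 by rewrite ler_pdivrMr// mulrC.
  lra.
have p01' : 0 <= p <= 1 by case/andP: p01 => /ltW-> /ltW->.
have : \sum_(k - h <= i < k.+1) b k / 2 <= 1.
  rewrite -[leRHS](bin_probT n p) /bin_prob -(big_mkord xpredT (binomial_pmf n p)).
  rewrite [leRHS](@big_cat_nat _ _ _ (k - h)) ?leq0n//=;
    last exact: leq_trans (leq_subr _ _) (leqW kn).
  rewrite [X in _ <= _ + X](@big_cat_nat _ _ _ k.+1 (k - h))//=;
    last exact: leq_trans (leq_subr _ _) (leqnSn _).
  have s0 a c : 0 <= \sum_(a <= i < c) binomial_pmf n p i by apply: sumr_ge0.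
  rewrite addrCA ler_wpDr//; first exact: addr_ge0.
  rewrite [leLHS]big_nat [leRHS]big_nat; apply: ler_sum => i; exact: half.
rewrite sumr_const_nat subSn ?leq_subr// subKn// -mulr_natr; lra.
Qed.

End PmfBound.

(** With h the integer part of sqrt (D / 2), the bound b k (h + 1) <= 2 suffices, because np <= 2 D
    gives h + 1 >= sqrt (np) / 2. *)
Lemma binomial_pmf_sqrt_le (R : realType) n (p : R) k : 0 <= p <= 2^-1 ->
  binomial_pmf n p k * Num.sqrt (n%:R * p) <= 4.
Proof.
move=> /andP[p0 p2]; have [->|pn0] := eqVneq p 0.
  by rewrite mulr0 sqrtr0 mulr0.
have {pn0}p0 : 0 < p by rewrite lt_neqAle eq_sym pn0.
have p01 : 0 < p < 1 by rewrite p0; lra.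
have p01' : 0 < 1 - p < 1 by lra.
have [nk|kn] := ltnP n k.
  by rewrite binomial_pmfE bin_small// !mul0r.
pose D := n.+1%:R * p * (1 - p).
have Dge : n%:R * p <= D * 2.
  rewrite /D -[leRHS]mulrA -[leRHS]mulrA.
  apply: ler_pM; rewrite ?ler0n ?(ltW p0)//; first by rewrite ler_nat.
  rewrite ler_peMr ?(ltW p0)//; lra.
pose h := Num.truncn (Num.sqrt (D / 2)).
have np0 : 0 <= n%:R * p by rewrite mulr_ge0// ltW.
have D0 : 0 <= D / 2 by lra.
have hD : h%:R ^+ 2 <= D / 2.
  rewrite -[leRHS]sqr_sqrtr//; apply: lerXn2r; rewrite ?nnegrE ?sqrtr_ge0//.
  by rewrite truncn_le sqrtr_ge0.
have bh : binomial_pmf n p k * h.+1%:R <= 2.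
  have [kp|kp] := leP (n.+1%:R * p - 1) k%:R.
    by have := binomial_pmf_right_le p01 kn kp hD.
  (* Left of the mean, exchanging zeros and ones maps [k] to [n - k] and [p] to [1 - p]; [D] is
     unchanged. *)
  rewrite binomial_pmf_sym//; apply: (@binomial_pmf_right_le _ _ _ p01' (n - k) h).
  - exact: leq_subr.
  - by rewrite natrB//; move: kp; rewrite -natr1; lra.
  - by rewrite opprB addrCA subrr addr0; apply: (le_trans hD); rewrite /D; lra.
have sh : Num.sqrt (n%:R * p) <= 2 * h.+1%:R.
  rewrite -ler_pdivrMl//; apply: le_trans (ltW (truncnS_gt _)).
  have e2 : 2^-1 = Num.sqrt (4^-1) :> R.
    have -> : 4^-1 = 2^-1 ^+ 2 :> R by field.
    by rewrite sqrtr_sqr ger0_norm.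
  rewrite [X in X * _]e2 -sqrtrM//; apply: ler_wsqrtr; lra.
apply: (le_trans (ler_wpM2l _ sh)).
  by apply: binomial_pmf_ge0; lra.
lra.
Qed.

(** Counts the integers of a real interval; cutting the interval at [N] is what makes the bound
    provable by induction. *)
Lemma count_window_le (R : realType) (N : nat) (a c : R) :
  \sum_(k < N | a <= k%:R <= c) 1 <= Num.max 0 (Num.min N%:R (c + 1) - a) :> R.
Proof.
elim: N => [|N IH]; first by rewrite big_mkcond big_ord0 le_max lexx.
rewrite big_mkcond big_ord_recr -big_mkcond /=; case: ifP => [/andP[aN Nc]|_]; last first.
  rewrite addr0; apply: (le_trans IH); rewrite ge_max le_max lexx/= le_max.
  by rewrite lerB ?orbT// le_min ge_min ler_nat leqnSn/= ge_min lexx orbT.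
apply: (le_trans (lerD IH (lexx _))).
have -> : Num.min N%:R (c + 1) = N%:R by apply: min_l; lra.
have -> : Num.min N.+1%:R (c + 1) = N.+1%:R by apply: min_l; rewrite -natr1; lra.
rewrite max_r ?subr_ge0// max_r; rewrite -natr1; lra.
Qed.

(** The window contains at most 2u + 1 <= 3u integers, each of probability at most 4 / sqrt (np). *)
Lemma bin_prob_window_le (R : realType) n (p u : R) : 0 <= p <= 2^-1 -> 1 <= u ->
  bin_prob n p (fun k => `|k%:R - n%:R * p| <= u) * Num.sqrt (n%:R * p) <= 12 * u.
Proof.
move=> p2 u1; rewrite /bin_prob big_distrl /=.
apply: (@le_trans _ _ (\sum_(k < n.+1 | `|k%:R - n%:R * p| <= u) 4)).
  by apply: ler_sum => k _; exact: binomial_pmf_sqrt_le.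
have -> : \sum_(k < n.+1 | `|k%:R - n%:R * p| <= u) 4 =
    4 * \sum_(k < n.+1 | n%:R * p - u <= k%:R <= n%:R * p + u) 1 :> R.
  by rewrite big_distrr /=; apply: eq_big => [k|k _]; rewrite ?mulr1// ler_distl.
have := @count_window_le R n.+1 (n%:R * p - u) (n%:R * p + u).
set S := \sum_(_ < _ | _) _ => h.
have : S <= 3 * u; last by lra.
apply: (le_trans h); rewrite ge_max; apply/andP; split; first lra.
rewrite lerBlDr ge_min; apply/orP; right; lra.
Qed.

(** * Lower bounds on binomial tails *)

(** A lower bound for one factor of the moment generating function, needed for the first moment in
    the Paley-Zygmund argument. The second-order terms compare as 4/5 * 53/100 <= 1/2 - 1/20. *)
Lemma expR_lower_cumulant (R : realType) (p lam : R) :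
  0 <= p <= 2^-1 -> 0 <= lam <= 6^-1 ->
  expR (lam * p + p * lam ^+ 2 / 20) <= 1 - p + p * expR lam.
Proof.
move=> /andP[p0 p2] /andP[l0 l6].
set z := _ + _ / 20.
have zE : z = p * lam * (1 + lam / 20) by rewrite /z; field.
have pl0 : 0 <= p * lam by rewrite mulr_ge0.
have pl1 : p * lam <= 12^-1.
  by have := ler_pM p0 l0 p2 l6; lra.
have z0 : 0 <= z by rewrite zE mulr_ge0//; lra.
have z1 : z <= 11^-1.
  have h : 1 + lam / 20 <= 121 / 120 by lra.
  have h0 : 0 <= 1 + lam / 20 by lra.
  rewrite zE; have := ler_pM pl0 h0 pl1 h; lra.
have z01 : 0 <= z <= 11^-1 by rewrite z0.
apply: (le_trans (expR_le_quad_small z01)).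
have := ler_wpM2l p0 (expR_ge1Dx2 l0).
have l2 := sqr_ge0 lam.
have pl2 : 0 <= p * lam ^+ 2 by rewrite mulr_ge0.
have : z ^+ 2 <= p * lam ^+ 2 * (53 / 100).
  have -> : z ^+ 2 = p * lam ^+ 2 * (p * (1 + lam / 20) ^+ 2) by rewrite zE; ring.
  apply: ler_wpM2l => //.
  have h : (1 + lam / 20) ^+ 2 <= 53 / 50 by nra.
  have h0 := sqr_ge0 (1 + lam / 20).
  have := ler_pM p0 h0 p2 h; lra.
rewrite {2}/z; lra.
Qed.

(* Paley-Zygmund for exp (lam (X - np)): its second moment is at most
   V = exp (4 np lam^2), and AM-GM gives Z <= Z^2 / (4 V) + V on the event. *)
Lemma bin_prob_ge_paley_zygmund (R : realType) n (p lam : R) (E : pred nat) :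
  0 <= p <= 2^-1 -> 0 <= lam <= 6^-1 ->
  (forall k : nat, ~~ E k ->
     lam * (k%:R - n%:R * p) <= n%:R * p * lam ^+ 2 / 20 - ln 2) ->
  expR (- (4 * (n%:R * p * lam ^+ 2))) / 4 <= bin_prob n p E.
Proof.
move=> p2 l6 HE; have p01 : 0 <= p <= 1 by lra.
have [p0 _] := andP p2; have [l0 _] := andP l6.
pose b := binomial_pmf n p.
pose Z k : R := expR (lam * (k%:R - n%:R * p)).
pose M := \sum_(k < n.+1) b k * Z k.
pose V : R := expR (4 * (n%:R * p * lam ^+ 2)).
have V0 : 0 < V by exact: expR_gt0.
have b0 k : 0 <= b k by exact: binomial_pmf_ge0.
have Mge : expR (n%:R * p * lam ^+ 2 / 20) <= M.
  have -> : M = expR (- (lam * (n%:R * p))) * (1 - p + p * expR lam) ^+ n.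
    have := binomial_pmf_expR n p lam 0; rewrite oppr0 add0r => <-.
    by apply: eq_bigr => k _; rewrite addr0.
  have h : expR (lam * p + p * lam ^+ 2 / 20) ^+ n <= (1 - p + p * expR lam) ^+ n.
    have h1 := expR_lower_cumulant p2 l6.
    by apply: lerXn2r => //; rewrite nnegrE ?(le_trans _ h1) ?expR_ge0.
  apply: le_trans (ler_wpM2l (expR_ge0 _) h).
  rewrite -expRM_natl -expRD ler_expR; lra.
have Vge : \sum_(k < n.+1) b k * Z k ^+ 2 <= V.
  have -> : \sum_(k < n.+1) b k * Z k ^+ 2 =
      expR (- (2 * lam * (n%:R * p))) * (1 - p + p * expR (2 * lam)) ^+ n.
    have := binomial_pmf_expR n p (2 * lam) 0; rewrite oppr0 add0r => <-.
    apply: eq_bigr => k _; rewrite addr0 /Z -expRM_natl; congr (_ * expR _); ring.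
  apply: (le_trans (ler_wpM2l (expR_ge0 _) (bin_mgf_le n p01 _))).
  rewrite -expRD ler_expR.
  have h : expR (2 * lam) <= 1 + 2 * lam + (2 * lam) ^+ 2 by apply: expR_le_quad; lra.
  have np0 : 0 <= n%:R * p by rewrite mulr_ge0.
  have := ler_wpM2l np0 h; lra.
have M1 : 1 <= M.
  apply: le_trans Mge; rewrite -[leLHS]expR0 ler_expR.
  by rewrite !mulr_ge0 ?sqr_ge0.
(* Off [E] the hypothesis gives [Z k <= M / 2]; on [E] the AM-GM bound applies. As [M >= 1], this
   leaves [1 / 4 <= V * bin_prob n p E]. *)
have HM : M <= M / 2 + 4^-1 + V * bin_prob n p E.
  have -> : M / 2 = \sum_(k < n.+1) b k * (M / 2).
    by rewrite -big_distrl /= -/(bin_prob n p predT) bin_probT mul1r.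
  have -> : V * bin_prob n p E = \sum_(k < n.+1) b k * (if E k then V else 0).
    rewrite big_distrr big_mkcond /=; apply: eq_bigr => k _.
    by case: ifP; rewrite ?mulr0// mulrC.
  apply: (@le_trans _ _ (\sum_(k < n.+1) b k * (M / 2) +
      (\sum_(k < n.+1) b k * Z k ^+ 2) / (4 * V) +
      \sum_(k < n.+1) b k * (if E k then V else 0))); last first.
    rewrite lerD2r lerD2l ler_pdivrMr ?mulr_gt0//; lra.
  rewrite [X in _ + X + _]big_distrl -!big_split /=; apply: ler_sum => k _.
  rewrite -mulrA -!mulrDr; apply: ler_wpM2l => //.
  have ZV : 0 <= Z k ^+ 2 / (4 * V) by rewrite divr_ge0 ?sqr_ge0 ?mulr_ge0 ?ltW.
  case: ifPn => Ek.
    have : 0 <= (Z k - 2 * V) ^+ 2 / (4 * V) by rewrite divr_ge0 ?sqr_ge0 ?mulr_ge0 ?ltW.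
    have -> : (Z k - 2 * V) ^+ 2 / (4 * V) = Z k ^+ 2 / (4 * V) - Z k + V.
      by field; rewrite gt_eqF.
    lra.
  rewrite addr0 ler_wpDr//; rewrite ler_pdivlMr//; apply: le_trans Mge.
  rewrite -[X in _ * X]lnK ?posrE// -expRD ler_expR.
  have := HE k Ek; lra.
rewrite expRN -/V mulrC ler_pdivrMr//; lra.
Qed.

(** This is (n/k)^k <= C(n,k) without division. The induction uses (k + 1) C(n + 1, k + 1) = (n + 1)
    C(n, k) and (n + 1) k <= n (k + 1). *)
Lemma expn_le_bin (n k : nat) : (k <= n)%N -> (n ^ k <= 'C(n, k) * k ^ k)%N.
Proof.
elim: n k => [|n IH] [|k]; rewrite ?bin0 ?expn0// ltnS => kn.
rewrite !expnS mulnA [('C(_, _) * _)%N]mulnC -mul_bin_diag /= -mulnA leq_mul2l /=.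
have [->|k0] := posnP k; first by rewrite !expn0 bin0.
rewrite -(@leq_pmul2r (k ^ k)) ?expn_gt0 ?k0//.
rewrite mulnAC; apply: leq_trans (leq_mul (IH _ kn) (leqnn _)).
by rewrite -!expnMn leq_exp2r// mulSn mulnS leq_add2r.
Qed.

Lemma bin_prob_ge_pmf (R : realType) n (p : R) (E : pred nat) k :
  0 <= p <= 1 -> (k <= n)%N -> E k -> binomial_pmf n p k <= bin_prob n p E.
Proof.
move=> p01 kn Ek; rewrite -ltnS in kn.
rewrite /bin_prob (bigD1 (Ordinal kn)) //= ler_wpDr//.
by apply: sumr_ge0 => i _; exact: binomial_pmf_ge0.
Qed.

Lemma onem_ge_expR (R : realType) (p : R) : 0 <= p <= 2^-1 -> expR (- (2 * p)) <= 1 - p.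
Proof.
move=> p2; have h := expR_ge1Dx (2 * p).
have p1 : 0 <= 1 - p by lra.
rewrite expRN -[leLHS]div1r ler_pdivrMr ?expR_gt0//.
apply: le_trans (ler_wpM2l p1 h); nra.
Qed.

(* A single term of the binomial sum, just above np + u, is large enough. *)
Lemma bin_prob_ge_large_dev (R : realType) n (p x u : R) :
  0 < p <= 2^-1 -> expR 1 <= x -> 1 <= u -> 8 * u <= n%:R ->
  72 * (u * ln x) <= x * (n%:R * p) ->
  expR (- (11 / 12 * (x * (n%:R * p)))) <=
  bin_prob n p (fun k => n%:R * p + u < k%:R).
Proof.
move=> /andP[p0 p2] xe u1 un; set L := x * _ => uL.
have p01 : 0 <= p <= 1 by lra.
have n0 : 0 < n%:R :> R by lra.
have np0 : 0 < n%:R * p by rewrite mulr_gt0.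
have x25 : 5 / 2 <= x by apply: le_trans (expR1_ge52 R) xe.
have x0 : 0 < x by lra.
have lx : 1 <= ln x by rewrite -[leLHS](expRK 1) ler_ln ?posrE ?expR_gt0.
(* The least integer above np + u; it is at most np + 2u because u >= 1, hence at most n because np
   <= n/2 and 8u <= n. *)
pose k := (Num.truncn (n%:R * p + u)).+1.
have /andP[k1 k2] : n%:R * p + u < k%:R <= n%:R * p + 2 * u.
  have h : 0 <= n%:R * p + u by lra.
  have := truncn_itv h; rewrite -/k => /andP[h1 h2]; rewrite h2 /=.
  rewrite /k -natr1; lra.
have npn : n%:R * p <= n%:R / 2 by rewrite ler_pM2l.
have kn : (k <= n)%N by rewrite -(ler_nat R); lra.
apply: (@le_trans _ _ (binomial_pmf n p k)); last exact: bin_prob_ge_pmf.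
have k0 : 0 < k%:R :> R by lra.
pose w := k%:R - n%:R * p.
have w0 : 0 < w by rewrite /w; lra.
have w2 : w <= 2 * u by rewrite /w; lra.
pose r := k%:R / (n%:R * p).
have r0 : 0 < r by rewrite divr_gt0.
have rE : r = 1 + w / (n%:R * p) by rewrite /r /w; field; rewrite !gt_eqF.
have uL1 : 72 * u <= L by apply: le_trans uL; rewrite ler_pM2l// ler_peMr; lra.
have rx : r <= x ^+ 2.
  have : w / (n%:R * p) <= x by rewrite ler_pdivrMr// -/L; lra.
  rewrite rE; nra.
have lr : ln r <= 2 * ln x.
  have -> : 2 * ln x = ln (x ^+ 2) by rewrite lnXn// mulr_natl.
  by rewrite ler_ln ?posrE ?exprn_gt0.
(* Write k = np + w. The first part contributes at most w by ln (1 + y) <= y, the second at most 2 w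
   ln x; the total is at most 6 u ln x, and 72 = 6 * 12. *)
have klr : k%:R * ln r <= L / 12.
  have h1 : n%:R * p * ln r <= w.
    rewrite mulrC -ler_pdivlMr// rE; apply: le_ln1Dx.
    have : 0 < w / (n%:R * p) by rewrite divr_gt0.
    lra.
  have h2 : w * ln r <= w * (2 * ln x) by rewrite ler_pM2l.
  have h3 : w <= w * ln x by rewrite ler_peMr// ltW.
  have h4 : w * ln x <= 2 * u * ln x by rewrite ler_wpM2r//; lra.
  have -> : k%:R = n%:R * p + w :> R by rewrite /w; ring.
  lra.
apply: (@le_trans _ _ (r ^- k * (1 - p) ^+ n)).
  have -> : r ^- k = expR (- (k%:R * ln r)).
    by rewrite expRN expRM_natl lnK ?posrE.
  have h : expR (- (2 * p)) ^+ n <= (1 - p) ^+ n.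
    apply: lerXn2r; rewrite ?nnegrE ?expR_ge0//; first lra.
    by apply: onem_ge_expR; lra.
  apply: le_trans (ler_wpM2l (expR_ge0 _) h).
  rewrite -expRM_natl -expRD ler_expR.
  (* Since x >= 5/2, the exponent is at most L/12 + 2np <= L/12 + 4L/5 <= 11L/12. *)
  have : 5 / 2 * (n%:R * p) <= L by rewrite ler_pM2r.
  lra.
rewrite binomial_pmfE mulrA.
have h1 : r ^- k <= 'C(n, k)%:R * p ^+ k.
  rewrite -exprVn /r invf_div expr_div_n exprMn ler_pdivrMr ?exprn_gt0//.
  rewrite mulrAC ler_wpM2r ?exprn_ge0 ?(ltW p0)// -!natrX -natrM ler_nat.
  exact: expn_le_bin.
apply: ler_pM => //.
- by rewrite invr_ge0 exprn_ge0 ?ltW.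
- by rewrite exprn_ge0//; lra.
- by apply: ler_wiXn2l; rewrite ?leq_subr//; lra.
Qed.

(** The counts n and n - 1 each have probability at least p^n. Both are kept because the factor 2
    later turns 1 / (J + 1) into at least 1 / J. *)
Lemma bin_prob_top_ge (R : realType) n (p : R) (E : pred nat) : (0 < n)%N ->
  0 <= p <= 2^-1 -> E n -> E n.-1 -> 2 * p ^+ n <= bin_prob n p E.
Proof.
case: n => // n _ /andP[p0 p2] En En1.
rewrite /bin_prob big_mkcond !big_ord_recr /= En En1.
rewrite !binomial_pmfE binSn binn subSnn subnn expr0 expr1 mulr1 mul1r.
have : p ^+ n.+1 <= n.+1%:R * (p ^+ n * (1 - p)).
  rewrite exprSr -[leLHS]mul1r; apply: ler_pM => //.
  - by rewrite mulr_ge0 ?exprn_ge0.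
  - by rewrite ler1n.
  - by rewrite ler_wpM2l ?exprn_ge0//; lra.
suff : 0 <= \sum_(i < n) (if E i then binomial_pmf n.+1 p i else 0) by lra.
apply: sumr_ge0 => i _; case: ifP => // _; apply: binomial_pmf_ge0; lra.
Qed.

(** * Deviations on the scale of phi *)

Lemma bin_prob_setU (R : realType) n (p : R) (E F G : pred nat) : 0 <= p <= 1 ->
  (forall k, (k <= n)%N -> E k -> F k || G k) ->
  bin_prob n p E <= bin_prob n p F + bin_prob n p G.
Proof.
move=> p01 EFG; rewrite /bin_prob [leLHS]big_mkcond [X in _ <= X + _]big_mkcond
  [X in _ <= _ + X]big_mkcond -big_split /=.
apply: ler_sum => k _; have b0 := binomial_pmf_ge0 n k p01.
have kn : (k <= n)%N by rewrite -ltnS.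
have := EFG k kn; case: (E k) => [/(_ isT) + |_]; case: (F k); case: (G k) => //=;
  rewrite ?addr0 ?add0r ?lerDl //; exact: addr_ge0.
Qed.

Lemma bin_prob0 (R : realType) n (p : R) (E : pred nat) :
  (forall k, (k <= n)%N -> ~~ E k) -> bin_prob n p E = 0.
Proof.
move=> nE; apply: big1 => k Ek; have kn : (k <= n)%N by rewrite -ltnS.
by have := nE k kn; rewrite Ek.
Qed.

(** Chernoff's bound with parameter ln x, for which nq exp (ln x) = L. Since ln x < x the hypothesis
    forces q < t, so a deviation of 20 t can only be upward. *)
Lemma bin_prob_upper_tail (R : realType) n (q L t : R) : (0 < n)%N ->
  0 < q <= 2^-1 -> 0 < L -> expR 1 * (n%:R * q) <= L ->
  L <= n%:R * t * ln (L / (n%:R * q)) ->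
  bin_prob n q (fun k => 20 * t <= `|k%:R / n%:R - q|) <= expR (- (3 * L)).
Proof.
move=> n0 /andP[q0 q2] L0 xe Lt.
have n0R : 0 < n%:R :> R by rewrite ltr0n.
have nq0 : 0 < n%:R * q by rewrite mulr_gt0.
pose x := L / (n%:R * q).
have xE : L = n%:R * q * x by rewrite /x; field; rewrite !gt_eqF.
have x0 : 0 < x by rewrite divr_gt0.
have xe' : expR 1 <= x by rewrite ler_pdivlMr.
have lx : 1 <= ln x by rewrite -[leLHS](expRK 1) ler_ln ?posrE ?expR_gt0.
have t0 : 0 < t.
  by have := lt_le_trans L0 Lt; rewrite pmulr_lgt0 ?pmulr_rgt0//; lra.
have Lq : n%:R * q < n%:R * t.
  rewrite -(ltr_pM2r x0) -xE; apply: (le_lt_trans Lt).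
  by rewrite ltr_pM2l ?mulr_gt0// ln_sublinear.
have p01 : 0 <= q <= 1 by lra.
apply: (@le_trans _ _ (bin_prob n q (fun k => 20 * L <= ln x * (k%:R - n%:R * q)))).
  apply: le_bin_prob => // k; rewrite !unfold_in => h.
  have kE : k%:R = n%:R * (k%:R / n%:R) :> R by field; rewrite gt_eqF.
  have h' : 20 * t <= k%:R / n%:R - q.
    move: h; rewrite ler_normr => /orP[//|].
    have : 0 <= k%:R / n%:R :> R by rewrite divr_ge0.
    have : q < t by rewrite ltr_pM2l in Lq.
    by lra.
  rewrite {}kE -mulrBr.
  apply: (@le_trans _ _ (ln x * (n%:R * (20 * t)))); first by rewrite -/x in Lt; lra.
  rewrite ler_wpM2l ?(le_trans _ lx)// ler_wpM2l//.
apply: (le_trans (@bin_prob_chernoff _ _ _ p01 _ _ _ (fun k h => h))).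
rewrite ler_expR lnK ?posrE// mulrBr mulrBr -xE mulr1.
have : 0 <= n%:R * q * ln x by rewrite mulr_ge0 ?(ltW nq0)//; lra.
lra.
Qed.

(** Chernoff's bound for each tail with parameters sqrt x / 6 and - sqrt x / 6, of modulus at most
    1/3. The exponent is at most L/36 - 20L/6 <= - 3L. *)
Lemma bin_prob_moderate_tail (R : realType) n (q L t : R) : (0 < n)%N ->
  0 < q <= 2^-1 -> 0 < L -> L <= expR 1 * (n%:R * q) ->
  Num.sqrt (q * L / n%:R) <= t ->
  bin_prob n q (fun k => 20 * t <= `|k%:R / n%:R - q|) <= 2 * expR (- (3 * L)).
Proof.
move=> n0 /andP[q0 q2] L0 xe st.
have n0R : 0 < n%:R :> R by rewrite ltr0n.
have nq0 : 0 < n%:R * q by rewrite mulr_gt0.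
have p01 : 0 <= q <= 1 by lra.
pose x := L / (n%:R * q).
have xE : L = n%:R * q * x by rewrite /x; field; rewrite !gt_eqF.
have x0 : 0 <= x by rewrite divr_ge0 ?ltW.
have x4 : x <= 4.
  by rewrite ler_pdivrMr//; apply: (le_trans xe); rewrite ler_pM2r//; have := expR1_le3 R; lra.
pose s := Num.sqrt x.
have s0 : 0 <= s by exact: sqrtr_ge0.
have s2 : s ^+ 2 = x by rewrite sqr_sqrtr.
have sle : s <= 2 by nra.
have {}st : q * s <= t.
  apply: le_trans st.
  have -> : q * L / n%:R = q ^+ 2 * x by rewrite /x; field; rewrite !gt_eqF.
  by rewrite sqrtrM ?sqr_ge0// sqrtr_sqr gtr0_norm.
have tail (lam : R) : lam ^+ 2 = x / 36 -> lam <= 3^-1 ->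
    bin_prob n q (fun k => 20 / 6 * L <= lam * (k%:R - n%:R * q)) <= expR (- (3 * L)).
  move=> lE l3; apply: (le_trans (@bin_prob_chernoff _ _ _ p01 _ _ _ (fun k h => h))).
  rewrite ler_expR.
  have h : n%:R * q * (expR lam - 1 - lam) <= n%:R * q * (x / 36).
    rewrite ler_wpM2l ?(ltW nq0)//; have := expR_le_quad l3; lra.
  apply: (le_trans (lerB h (lexx _))); rewrite mulrA -xE; lra.
have lE : (s / 6) ^+ 2 = x / 36 by rewrite -s2; field.
have lE' : (- (s / 6)) ^+ 2 = x / 36 by rewrite sqrrN.
apply: (@le_trans _ _ (expR (- (3 * L)) + expR (- (3 * L)))); last lra.
have l3 : s / 6 <= 3^-1 by lra.
have l3' : - (s / 6) <= 3^-1 by lra.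
apply: le_trans (lerD (tail _ lE l3) (tail _ lE' l3')).
apply: bin_prob_setU => // k kn.
have kE : k%:R = n%:R * (k%:R / n%:R) :> R by field; rewrite gt_eqF.
have main y : 20 * t <= y -> 20 / 6 * L <= s / 6 * (n%:R * y).
  move=> h; have {}h : 20 * (q * s) <= y by lra.
  have -> : 20 / 6 * L = s / 6 * (n%:R * (20 * (q * s))) by rewrite xE -s2; field.
  rewrite ler_wpM2l ?ler_wpM2l// divr_ge0//.
rewrite ler_normr => /orP[] /main h.
  by rewrite {1}kE -mulrBr h.
by rewrite {2}kE -mulrBr mulNr -mulrN -mulrN h orbT.
Qed.

(** * Case analysis and elementary bounds for [phi] *)

Lemma ln_inv_gt0 (R : realType) (q : R) : 0 < q <= 2^-1 -> 0 < ln q^-1.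
Proof. by move=> /andP[q0 q2]; rewrite lnV ?posrE// oppr_gt0 ln_lt0// q0; lra. Qed.

(** Replaces the nested tests of [phi] by one case split, with the thresholds on [n] cleared of
    denominators. *)
Variant phi_spec (R : realType) (J q : R) (n : nat) : R -> Prop :=
| PhiZero of q = 0 : phi_spec J q n 0
| PhiSmall of 0 < q & J < 1 :
    phi_spec J q n (expR (- J^-1) * Num.sqrt (q / n%:R))
| PhiOne of 0 < q & 1 <= J & n%:R * ln q^-1 <= ln (J + 1) : phi_spec J q n 1
| PhiLarge of 0 < q & 1 <= J & ln (J + 1) < n%:R * ln q^-1 &
    expR 1 * (n%:R * q) <= ln (J + 1) :
    phi_spec J q n (ln (J + 1) / (n%:R * ln (ln (J + 1) / (n%:R * q))))
| PhiModerate of 0 < q & 1 <= J & ln (J + 1) <= expR 1 * (n%:R * q) :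
    phi_spec J q n (Num.sqrt (q * ln (J + 1) / n%:R)).

Lemma phiP (R : realType) (J q : R) n : (0 < n)%N -> 0 <= q <= 2^-1 ->
  phi_spec J q n (phi J q n).
Proof.
move=> n0 /andP[q0 q2]; rewrite /phi; case: eqVneq => [->|qn0]; first exact: PhiZero.
have {qn0}q0 : 0 < q by rewrite lt_neqAle eq_sym qn0.
have n0R : 0 < n%:R :> R by rewrite ltr0n.
case: ltP => [J1|J1]; first exact: PhiSmall.
have lq : 0 < ln q^-1 by apply: ln_inv_gt0; rewrite q0.
rewrite ler_pdivlMr//; case: leP => [h|h]; first exact: PhiOne.
rewrite ler_pdivlMr ?mulr_gt0 ?expR_gt0// mulrCA.
by case: leP => h2; [exact: PhiLarge|apply: PhiModerate => //; exact: ltW].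
Qed.

Lemma phi_ge0 (R : realType) (J q : R) n : (0 < n)%N -> 0 <= q <= 2^-1 ->
  0 <= phi J q n.
Proof.
move=> n0 q2; case: (phiP J n0 q2) => // q0 J1 _ xe.
have n0R : 0 < n%:R :> R by rewrite ltr0n.
rewrite divr_ge0 ?mulr_ge0 ?ln_ge0//; first lra.
rewrite ler_pdivlMr ?mulr_gt0// mul1r; apply: le_trans xe.
by rewrite ler_peMl ?mulr_ge0 ?(ltW q0)//; have := expR1_ge52 R; lra.
Qed.

Lemma phi_large_ln_ge1 (R : realType) (L q : R) n : (0 < n)%N -> 0 < q ->
  expR 1 * (n%:R * q) <= L -> 1 <= ln (L / (n%:R * q)).
Proof.
move=> n0 q0 xe; have nq0 : 0 < n%:R * q by rewrite mulr_gt0// ltr0n.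
have L0 : 0 < L by apply: lt_le_trans xe; rewrite mulr_gt0 ?expR_gt0.
by rewrite -[leLHS](expRK 1) ler_ln ?posrE ?expR_gt0 ?divr_gt0// ler_pdivlMr.
Qed.

Lemma phi_gt0 (R : realType) (J q : R) n : (0 < n)%N -> 0 < q <= 2^-1 ->
  0 < J -> 0 < phi J q n.
Proof.
move=> n0 /andP[q0 q2] J0; have n0R : 0 < n%:R :> R by rewrite ltr0n.
have L0 : 0 < ln (J + 1) by rewrite ln_gt0// ltrDr.
have q02 : 0 <= q <= 2^-1 by rewrite ltW.
case: (phiP J n0 q02) => // [qE|_ _|_ _ _ xe|_ _ _].
- by rewrite qE ltxx in q0.
- by rewrite mulr_gt0 ?expR_gt0// sqrtr_gt0 divr_gt0.
- rewrite divr_gt0 ?mulr_gt0//; apply: lt_le_trans (phi_large_ln_ge1 n0 q0 xe).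
  exact: ltr01.
- by rewrite sqrtr_gt0 divr_gt0 ?mulr_gt0.
Qed.

Lemma phi_le1 (R : realType) (J q : R) n : (0 < n)%N -> 0 <= q <= 2^-1 ->
  0 < J -> phi J q n <= 1.
Proof.
move=> n0 q02 J0; have n0R : 0 < n%:R :> R by rewrite ltr0n.
have n1R : 1 <= n%:R :> R by rewrite ler1n.
have L0 : 0 < ln (J + 1) by rewrite ln_gt0// ltrDr.
case: (phiP J n0 q02) => // [q0 J1|q0 J1 vq xe|q0 J1 xe].
- apply: mulr_ile1; rewrite ?expR_ge0 ?sqrtr_ge0//.
    by rewrite expR_le1 oppr_le0 invr_ge0 ltW.
  rewrite -[leRHS]sqrtr1; apply: ler_wsqrtr; rewrite ler_pdivrMr//; lra.
- have lx := phi_large_ln_ge1 n0 q0 xe; set lx' := ln (_ / _) in lx *.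
  have lx0 : 0 < lx' by lra.
  rewrite ler_pdivrMr ?mulr_gt0// mul1r -ler_pdivrMl//.
  have vE : n%:R^-1 * ln (J + 1) = ln (J + 1) / n%:R by rewrite mulrC.
  rewrite {}vE; set v := _ / n%:R.
  have v0 : 0 < v by rewrite divr_gt0.
  have {}vq : v < ln q^-1 by rewrite ltr_pdivrMr// mulrC.
  (* For v <= 1 the bound ln x >= 1 suffices; otherwise ln x = ln v + ln (1/q) with ln v >= 0 and ln
     (1/q) > v. *)
  have [v1|v1] := leP 1 v; last lra.
  have -> : lx' = ln v + ln q^-1.
    rewrite -lnM ?posrE ?invr_gt0//; congr ln; rewrite /v; field.
    by rewrite !gt_eqF.
  have := ln_ge0 v1; lra.
- rewrite -[leRHS]sqrtr1; apply: ler_wsqrtr; rewrite ler_pdivrMr// mul1r.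
  have /andP[_ q2] := q02.
  apply: (le_trans (ler_wpM2l (ltW q0) xe)); rewrite mulrCA mulrC -mulrA mulrA.
  have h : q * q <= 2^-1 * 2^-1 by apply: ler_pM => //; exact: ltW.
  have h3 := expR1_le3 R; have e0 := expR_ge0 (1:R).
  have qq : 0 <= q * q by rewrite mulr_ge0 ?ltW.
  have := ler_pM qq e0 h h3 => h4.
  rewrite -[leRHS]mul1r; nra.
Qed.

(** The level [s] may exceed [phi J q n] because it will be the supremum over all coordinates. Where
    [phi] is 1 a deviation of 20 is impossible; the other nonzero cases are the two Chernoff
    bounds. *)
Lemma bin_prob_dev_phi_le (R : realType) n (J q s : R) : (0 < n)%N ->
  0 <= q <= 2^-1 -> 1 <= J -> 0 < s -> phi J q n <= s ->
  bin_prob n q (fun k => 20 * s <= `|k%:R / n%:R - q|) <=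
    2 * expR (- (3 * ln (J + 1))).
Proof.
move=> n0 q02 J1 s0; have n0R : 0 < n%:R :> R by rewrite ltr0n.
set L := ln (J + 1).
have L0 : 0 < L by rewrite ln_gt0// ltrDr; lra.
have e0 := expR_gt0 (- (3 * L)).
case: (phiP J n0 q02) => // [q0|q0 J1'|q0 _ _ s1|q0 _ _ xe Ls|q0 _ xe Ls].
- move=> _; apply: (@le_trans _ _ 0); last lra.
  rewrite q0 /bin_prob big1// => -[[|k] kn] /=.
    by rewrite mul0r subrr normr0; lra.
  by move=> _; rewrite binomial_pmfE expr0n /= mul0r mulr0.
- by rewrite ltNge J1 in J1'.
- rewrite bin_prob0; first lra.
  move=> k kn; rewrite -ltNge ltr_norml.
  have h0 : 0 <= k%:R / n%:R :> R by rewrite divr_ge0.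
  have h1 : k%:R / n%:R <= 1 :> R by rewrite ler_pdivrMr// mul1r ler_nat.
  by apply/andP; split; lra.
- have lx := phi_large_ln_ge1 n0 q0 xe.
  have lx0 := lt_le_trans ltr01 lx.
  apply: (@le_trans _ _ (expR (- (3 * L)))); last lra.
  apply: bin_prob_upper_tail => //; first by rewrite q0; lra.
  by move: Ls; rewrite ler_pdivrMr ?mulr_gt0// mulrA [s * _]mulrC.
- by apply: bin_prob_moderate_tail => //; rewrite q0; lra.
Qed.

(** The window misses the upper tail, and 1 - 1/J <= exp (- 1/J). *)
Lemma bin_prob_window_le_of_tail (R : realType) n (p J u : R) : 0 <= p <= 1 ->
  J^-1 <= bin_prob n p (fun k => n%:R * p + u < k%:R) ->
  bin_prob n p (fun k => `|k%:R - n%:R * p| <= u) <= expR (- J^-1).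
Proof.
move=> p01 h; apply: le_trans (expR_ge1Dx _).
have := bin_probC n p (fun k => n%:R * p + u < k%:R).
suff : bin_prob n p (fun k => `|k%:R - n%:R * p| <= u) <=
   bin_prob n p (predC (fun k => n%:R * p + u < k%:R)) by lra.
apply: le_bin_prob => // k; rewrite !unfold_in /= -leNgt ler_norml.
by move=> /andP[_]; lra.
Qed.

Lemma lef_pV2_succ (R : realType) (J A : R) : 0 < J ->
  A + 1 <= J + 1 -> 0 < A -> J^-1 <= A^-1.
Proof. by move=> J0 h A0; rewrite lef_pV2 ?posrE//; lra. Qed.

Lemma expRN1_ge13 (R : realType) : 3^-1 <= expR (- 1) :> R.
Proof. by rewrite expRN lef_pV2 ?posrE ?expR_gt0// expR1_le3. Qed.

(* For bounded L the window is narrow compared to the standard deviation; for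
   large L the upper tail alone already has probability at least 1 / J. *)
Lemma bin_prob_window_moderate (R : realType) n (p J u : R) :
  0 < p <= 2^-1 -> 1 <= J -> ln (J + 1) <= 3 * (n%:R * p) -> 1 <= u ->
  u <= (50^-1 / 100) * Num.sqrt (n%:R * p * ln (J + 1)) ->
  bin_prob n p (fun k => `|k%:R - n%:R * p| <= u) <= expR (- J^-1).
Proof.
move=> /andP[p0 p2] J1; set L := ln (J + 1) => x3 u1 uL.
have p01 : 0 <= p <= 1 by lra.
have p02 : 0 <= p <= 2^-1 by lra.
have L0 : 0 < L by rewrite ln_gt0// ltrDr; lra.
have np0 : 0 < n%:R * p by lra.
have J0 : 0 < J by lra.
have eJ : 3^-1 <= expR (- J^-1).
  by apply: le_trans (expRN1_ge13 R) _; rewrite ler_expR lerN2 invf_le1.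
have s0 : 0 < Num.sqrt (n%:R * p) by rewrite sqrtr_gt0.
rewrite sqrtrM in uL; last exact: ltW.
have sL2 : Num.sqrt L ^+ 2 = L by rewrite sqr_sqrtr// ltW.
have sL0 : 0 <= Num.sqrt L by exact: sqrtr_ge0.
have snp2 : Num.sqrt (n%:R * p) ^+ 2 = n%:R * p by rewrite sqr_sqrtr// ltW.
(* Below this threshold the window has probability at most 12 * 80 / 5000 < 1/3; above it L/2880,
   the gain np lam^2 / 20, absorbs ln 2 and lam u. *)
have [L6|L6] := leP L (60 * 100).
  apply: le_trans eJ.
  rewrite -(ler_pM2r s0); apply: (le_trans (bin_prob_window_le n p02 u1)).
  have sL : Num.sqrt L <= 80 by nra.
  have := ler_wpM2l (ltW s0) sL; lra.
apply: bin_prob_window_le_of_tail => //.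
(* Chosen so that np lam^2 = L/144: the Paley-Zygmund bound is exp (- L/36) / 4, far above 1/J
   because J + 1 = exp L. *)
pose lam := Num.sqrt L / Num.sqrt (n%:R * p) / 12.
have lam0 : 0 <= lam by rewrite !divr_ge0 ?(ltW s0).
have lam2 : n%:R * p * lam ^+ 2 = L / 144.
  by rewrite /lam -[X in X * _]snp2 -[in RHS]sL2; field; rewrite gt_eqF.
have lam6 : lam <= 6^-1.
  have h : lam ^+ 2 <= 48^-1.
    rewrite -(ler_pM2l np0) lam2; lra.
  nra.
have l06 : 0 <= lam <= 6^-1 by rewrite lam0.
apply: le_trans (@bin_prob_ge_paley_zygmund _ n p lam _ p02 l06 _).
  rewrite lam2 expRN -invfM; apply: lef_pV2_succ => //; last by rewrite mulr_gt0 ?expR_gt0.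
  have -> : J + 1 = expR L by rewrite lnK// posrE; lra.
  have eL : L = 4 * (L / 144) + 35 / 36 * L by field.
  rewrite [in leRHS]eL expRD.
  have h1 := expR_ge1Dx (35 / 36 * L); have h2 := expR_ge1Dx (4 * (L / 144)).
  have h3 : expR (4 * (L / 144)) * 5 <= expR (4 * (L / 144)) * expR (35 / 36 * L).
    by rewrite ler_wpM2l ?expR_ge0//; lra.
  lra.
move=> k; rewrite -leNgt => ku; rewrite lam2.
have h : lam * (k%:R - n%:R * p) <= lam * ((50^-1 / 100) * (Num.sqrt (n%:R * p) * Num.sqrt L)).
  by rewrite ler_wpM2l//; lra.
apply: (le_trans h).
have -> : lam * ((50^-1 / 100) * (Num.sqrt (n%:R * p) * Num.sqrt L)) = L / 100 / 200 / 3.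
  by rewrite /lam -[in RHS]sL2; field; rewrite gt_eqF.
have : ln 2 <= 1 :> R.
  rewrite -[leRHS]expRK ler_ln ?posrE ?expR_gt0//.
  by have := expR1_ge52 R; lra.
lra.
Qed.

(** Two parameters occur because the window is set by [q], the parameter of coordinate j, while the
    count belongs to an earlier coordinate, of parameter [p >= q]. The lower bound on [phi] makes
    the window [u], measured in counts, at least 1. *)
Lemma bin_prob_window_phi_le (R : realType) n (p q J : R) : (0 < n)%N ->
  0 <= q <= p -> p <= 2^-1 -> 0 < J -> n%:R^-1 <= (100^-1 / 100) * phi J q n ->
  bin_prob n p (fun k => `|k%:R / n%:R - p| <= (100^-1 / 100) * phi J q n) <= expR (- J^-1).
Proof.
move=> n0 /andP[q0 qp] p2 J0; have n0R : 0 < n%:R :> R by rewrite ltr0n.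
have q02 : 0 <= q <= 2^-1 by lra.
have phi1 := phi_le1 n0 q02 J0.
set s := _ * phi J q n => ns.
pose u := n%:R * s.
have p01 : 0 <= p <= 1 by lra.
have u1 : 1 <= u by rewrite /u -ler_pdivrMl// mulr1.
have un : u <= n%:R / 100 / 100.
  have s1 : s <= 100^-1 / 100 by rewrite /s; lra.
  have := ler_wpM2l (ltW n0R) s1; rewrite -/u; lra.
apply: (@le_trans _ _ (bin_prob n p (fun k => `|k%:R - n%:R * p| <= u))).
  apply: le_bin_prob => // k; rewrite !unfold_in.
  have -> : k%:R - n%:R * p = n%:R * (k%:R / n%:R - p) by field; rewrite gt_eqF.
  by rewrite normrM gtr0_norm// ler_pM2l.
clear ns.
move: phi1 @s @u u1 un; case: (phiP J n0 q02) => //=.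
- by move=> _ _; rewrite !mulr0; lra.
(* For J < 1 the factor exp (- 1/J) is part of the window width, and the concentration bound
   transfers it to the probability. *)
- move=> {}q0 J1 _; set u := n%:R * _ => u1 _.
  have np0 : 0 < n%:R * p by rewrite mulr_gt0//; lra.
  have s0 : 0 < Num.sqrt (n%:R * p) by rewrite sqrtr_gt0.
  have p02 : 0 <= p <= 2^-1 by lra.
  rewrite -(ler_pM2r s0); apply: (le_trans (bin_prob_window_le n p02 u1)).
  have h : n%:R * Num.sqrt (q / n%:R) <= Num.sqrt (n%:R * p).
    rewrite -{1}(gtr0_norm n0R) -sqrtr_sqr -sqrtrM ?sqr_ge0//; apply: ler_wsqrtr.
    have -> : n%:R ^+ 2 * (q / n%:R) = n%:R * q by field; rewrite gt_eqF.
    by rewrite ler_pM2l.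
  have := ler_wpM2l (expR_ge0 (- J^-1)) h; rewrite /u.
  have : 0 <= expR (- J^-1) * (n%:R * Num.sqrt (q / n%:R)).
    by rewrite !mulr_ge0 ?expR_ge0 ?sqrtr_ge0.
  lra.
(* Here q^n >= 1 / (J + 1), and both top counts lie beyond np + u because np <= n/2 and u is tiny
   compared with n. *)
- move=> {}q0 J1 Lq _; rewrite mulr1; set u := n%:R * _ => u1 _.
  apply: bin_prob_window_le_of_tail => //.
  have n4 : 100 * 100 <= n%:R :> R by rewrite /u in u1; lra.
  have qn : (q^-1) ^+ n <= J + 1.
    rewrite -[leRHS]lnK ?posrE; last lra.
    by rewrite -[q^-1]lnK ?posrE ?invr_gt0// -expRM_natl ler_expR.
  have {}qn : (J + 1)^-1 <= p ^+ n.
    apply: (@le_trans _ _ (q ^+ n)); last by apply: lerXn2r; rewrite ?nnegrE; lra.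
    rewrite -[leRHS]invrK lef_pV2 ?posrE ?invr_gt0 ?exprn_gt0//; last lra.
    by rewrite -exprVn.
  have p02 : 0 <= p <= 2^-1 by lra.
  have npn : n%:R * p <= n%:R / 2 by rewrite ler_pM2l.
  apply: le_trans (bin_prob_top_ge n0 p02 _ _).
  + apply: (@le_trans _ _ (2 * (J + 1)^-1)); last by rewrite ler_pM2l.
    rewrite ler_pdivlMr; last lra.
    by rewrite mulrDr mulVf ?gt_eqF// mulr1 -lerBrDl; have : J^-1 <= 1; [rewrite invf_le1|lra].
  + rewrite /u; lra.
  + have -> : n.-1%:R = n%:R - 1 :> R by rewrite -[in RHS](prednK n0) -natr1; ring.
    rewrite /u; lra.
- move=> {}q0 J1 vq xe phi1; set L := ln (J + 1) in vq xe phi1 *.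
  have lx := phi_large_ln_ge1 n0 q0 xe.
  have lx0 := lt_le_trans ltr01 lx.
  have L0 : 0 < L by rewrite ln_gt0// ltrDr; lra.
  set u := n%:R * _ => u1 un.
  have {phi1} uE : u * ln (L / (n%:R * q)) = L / 100 / 100.
    by rewrite /u; field; rewrite !gt_eqF//.
  have p0 : 0 < p by lra.
  have np0 : 0 < n%:R * p by rewrite mulr_gt0.
  pose x := L / (n%:R * p).
  have xE : x * (n%:R * p) = L by rewrite /x; field; rewrite !gt_eqF.
  have x0 : 0 < x by rewrite divr_gt0.
  have xq : ln x <= ln (L / (n%:R * q)).
    rewrite ler_ln ?posrE ?divr_gt0 ?mulr_gt0//.
    by rewrite ler_pM2l// lef_pV2 ?posrE ?mulr_gt0// ler_pM2l.
  have u0 : 0 < u by lra.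
  have uL : u <= L / 100 / 100 by rewrite -uE ler_peMr// ltW.
  (* The regime is decided anew for x = L / (np), which may be smaller than L / (nq). For x < e, u
     <= L / 10^4 and L <= 2 sqrt (np L) give the constant 1/5000 of the moderate case. *)
  have [xe'|xe'] := leP (expR 1) x.
    apply: bin_prob_window_le_of_tail => //.
    apply: (@le_trans _ _ (expR (- (11 / 12 * (x * (n%:R * p)))))); last first.
      apply: bin_prob_ge_large_dev => //; first by rewrite p0.
        by lra.
      rewrite xE; have := ler_wpM2l (ltW u0) xq; lra.
    rewrite xE expRN; apply: lef_pV2_succ; rewrite ?expR_gt0//.
    have -> : J + 1 = expR L by rewrite lnK// posrE; lra.
    have eL : L = 11 / 12 * L + L / 12 by field.
    rewrite [in leRHS]eL expRD; have h1 := expR_ge1Dx (L / 12).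
    have h2 : 1 <= expR (11 / 12 * L).
      by rewrite -[leLHS]expR0 ler_expR mulr_ge0 ?ltW.
    have h3 : expR (11 / 12 * L) * 2 <= expR (11 / 12 * L) * expR (L / 12).
      by rewrite ler_wpM2l ?expR_ge0//; lra.
    lra.
  apply: bin_prob_window_moderate => //; first by rewrite p0.
    by rewrite -/L -xE ler_pM2r//; have := expR1_le3 R; lra.
  rewrite -/L; have -> : n%:R * p * L = x * (n%:R * p) ^+ 2 by rewrite -xE; ring.
  rewrite sqrtrM ?(ltW x0)// sqrtr_sqr gtr0_norm//.
  have x4 : x <= 4 by have := expR1_le3 R; lra.
  have sx0 : 0 < Num.sqrt x by rewrite sqrtr_gt0.
  have sx2 : Num.sqrt x ^+ 2 = x by rewrite sqr_sqrtr// ltW.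
  have sx : Num.sqrt x <= 2 by nra.
  apply: (le_trans uL); rewrite -xE -{1}sx2.
  have := ler_wpM2l (ltW sx0) sx => h.
  have := ler_wpM2r (ltW np0) h; lra.
- move=> {}q0 J1 xe _; set L := ln (J + 1) in xe *; set u := n%:R * _ => u1 _.
  have p0 : 0 < p by lra.
  have nqp : n%:R * q <= n%:R * p by rewrite ler_pM2l.
  have L0 : 0 < L by rewrite ln_gt0// ltrDr; lra.
  apply: bin_prob_window_moderate => //; first by rewrite p0.
    apply: (le_trans xe); apply: ler_pM; rewrite ?expR_ge0 ?expR1_le3//.
    by rewrite mulr_ge0 ?ltW.
  have h : n%:R * Num.sqrt (q * L / n%:R) <= Num.sqrt (n%:R * p * L).
    rewrite -{1}(gtr0_norm n0R) -sqrtr_sqr -sqrtrM ?sqr_ge0//; apply: ler_wsqrtr.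
    have -> : n%:R ^+ 2 * (q * L / n%:R) = n%:R * q * L by field; rewrite gt_eqF.
    by rewrite ler_pM2r.
  have : 0 <= Num.sqrt (n%:R * p * L) by exact: sqrtr_ge0.
  rewrite -/L /u; lra.
Qed.

(** * Joint law of the counts *)

(** Zero-one vectors are identified with subsets of ['I_n] and grouped by cardinality. *)
Lemma sum_ffun_bin_prob (R : realType) n (p : R) (E : pred nat) :
  \sum_(v : {ffun 'I_n -> bool} | E (\sum_i v i)%N)
    \prod_i (if v i then p else 1 - p) = bin_prob n p E.
Proof.
pose h (A : {set 'I_n}) : {ffun 'I_n -> bool} := [ffun i => i \in A].
have hb : bijective h.
  exists (fun v : {ffun 'I_n -> bool} => [set i | v i]%SET).
    by move=> A; apply/setP => i; rewrite inE ffunE.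
  by move=> v; apply/ffunP => i; rewrite ffunE inE.
rewrite (reindex h); last exact: onW_bij.
have hc A : (\sum_i h A i)%N = #|A|.
  by rewrite -sum1_card [RHS]big_mkcond; apply: eq_bigr => i _; rewrite ffunE; case: (i \in A).
have cA (A : {set 'I_n}) : (#|A| < n.+1)%N.
  by rewrite ltnS; have := max_card (mem A); rewrite card_ord.
have hp A : \prod_i (if h A i then p else 1 - p) = p ^+ #|A| * (1 - p) ^+ (n - #|A|).
  under eq_bigr do rewrite ffunE.
  rewrite (bigID (mem A)) /=.
  rewrite (eq_bigr (fun=> p)); last by move=> i ->.
  rewrite [X in _ * X](eq_bigr (fun=> 1 - p)); last by move=> i /negbTE ->.
  rewrite !prodr_const; congr (_ * _ ^+ _).
  apply: (@addnI #|A|); rewrite subnKC; last by have := cA A; rewrite ltnS.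
  by rewrite -[RHS]card_ord -(cardC (mem A)).
rewrite (eq_bigl (fun A : {set 'I_n} => E #|A|)); last by move=> A; rewrite hc.
rewrite (partition_big (fun A : {set 'I_n} => Ordinal (cA A)) (fun k : 'I_n.+1 => E k)) //=.
apply: eq_bigr => k Ek.
rewrite (eq_bigl (fun A : {set 'I_n} => A \in [set A : {set 'I_n} | #|A| == k]%SET)); last first.
  by move=> A; rewrite inE -val_eqE /=; case: eqP => [->|]; rewrite ?Ek ?andbF.
rewrite (eq_bigr (fun=> p ^+ k * (1 - p) ^+ (n - k))); last first.
  by move=> A; rewrite inE hp => /eqP ->.
by rewrite sumr_const card_draws card_ord.
Qed.

Section Counts.
Variables (R : realType) (n : nat) (p : nat -> R).
Variables (d : measure_display) (T : measurableType d) (P : probability T R).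
Variables (mu : probability binseq R) (X : 'I_n -> {RV P >-> binseq}).
Hypothesis p01 : forall j, 0 <= p j <= 1.
Hypothesis hmu : product_bernoulli p mu.
Hypothesis hX : iid_sample mu X.

Definition count_ones (j : nat) (t : T) : nat := (\sum_(i < n) Defs.coord j (X i t))%N.

Let w (j : nat) (b : bool) : R := if b then p j else 1 - p j.

Lemma measurable_coord j b : measurable (Defs.coord j @^-1` [set b] : set binseq).
Proof.
apply: sub_sigma_algebra; exists j, b.
by apply/seteqP; split => x.
Qed.

Lemma mu_cylinder (m : nat) (b : nat -> bool) :
  measurable ([set x | forall j, (j < m)%N -> x j = b j] : set binseq) /\
  mu [set x | forall j, (j < m)%N -> x j = b j] = (\prod_(j < m) w j (b j))%:E.
Proof.
have e : [set x : binseq | forall j, (j < m)%N -> x j = b j] =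
    \bigcap_(j in [set` iota 0 m]) (Defs.coord j @^-1` [set b j]).
  by apply/seteqP; split => x /= h j; [move=> hj|move=> hj]; apply: h;
    move: hj; rewrite /= mem_iota add0n.
rewrite e; split.
  apply: fin_bigcap_measurable => [|j _]; first exact: finite_seq.
  exact: measurable_coord.
have [ind law] := hmu.
rewrite (ind _ (fun j => [set b j])); [|exact: iota_uniq|by []].
rewrite (eq_bigr (fun j => (w j (b j))%:E)) => [|j _]; last first.
  have -> : mu (Defs.coord j @^-1` [set b j]) = pushforward mu (Defs.coord j) [set b j] by [].
  rewrite law bernoulli_probE// !diracE /w; case: (b j) => /=.
    by rewrite mem_set// memNset// mule1 mule0 adde0.
  by rewrite memNset// mem_set// mule1 mule0 add0e.
by rewrite prodEFin -{1}[m]subn0 -/(index_iota 0 m) big_mkord.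
Qed.

Let pat (m : nat) (b : nat -> 'I_n -> bool) : set T :=
  [set t | forall i (j : nat), (j < m)%N -> Defs.coord j (X i t) = b j i].

(** Independence is used twice: between samples here, and between coordinates inside
    [mu_cylinder]. *)
Lemma prob_pattern (m : nat) (b : nat -> 'I_n -> bool) :
  measurable (pat m b) /\
  P (pat m b) = (\prod_(j < m) \prod_i w j (b j i))%:E.
Proof.
pose C i : set binseq := [set x | forall j, (j < m)%N -> x j = b j i].
have mC i : measurable (C i) by have [] := mu_cylinder m (fun j => b j i).
have e : pat m b = \bigcap_(i in [set` enum 'I_n]) (X i @^-1` C i).
  apply/seteqP; split => t /= h i; first by move=> _ j hj; exact: h.
  by move=> j hj; apply: (h i) => //=; rewrite mem_enum.
have [ind law] := hX.
rewrite e; split.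
  apply: fin_bigcap_measurable => [|i _]; first exact: finite_seq.
  exact: measurable_funPTI.
rewrite (ind _ C)//; last exact: enum_uniq.
rewrite (eq_bigr (fun i => (\prod_(j < m) w j (b j i))%:E)) => [|i _]; last first.
  have [_ <-] := mu_cylinder m (fun j => b j i).
  exact: law.
by rewrite prodEFin big_enum /= exchange_big.
Qed.

(** The event is a finite disjoint union of patterns; distributivity turns the sum over zero-one
    matrices into a product over coordinates. *)
Lemma prob_counts (m : nat) (E : nat -> pred nat) :
  measurable [set t | forall j, (j < m)%N -> E j (count_ones j t)] /\
  P [set t | forall j, (j < m)%N -> E j (count_ones j t)] =
    (\prod_(j < m) bin_prob n (p j) (E j))%:E.
Proof.
pose Q (j : 'I_m) : pred {ffun 'I_n -> bool} := fun v => E j (\sum_i v i)%N.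
(* The default [false] is assigned only from index [m] on, where [pat m] imposes no condition. *)
pose b (f : {ffun 'I_m -> {ffun 'I_n -> bool}}) (j : nat) (i : 'I_n) : bool :=
  if insub j is Some j' then f j' i else false.
have bE f (j : 'I_m) i : b f j i = f j i by rewrite /b valK.
pose D : set {ffun 'I_m -> {ffun 'I_n -> bool}} := [set` family Q].
have e : [set t | forall j, (j < m)%N -> E j (count_ones j t)] =
    \bigcup_(f in D) pat m (b f).
  apply/seteqP; split => t /=.
    move=> h; exists [ffun j : 'I_m => [ffun i => Defs.coord j (X i t)]].
      apply/familyP => j; rewrite unfold_in /Q ffunE.
      by under eq_bigr do rewrite ffunE; exact: h.
    by move=> i j jm; rewrite -[j]/(val (Ordinal jm)) bE !ffunE.
  move=> [f /familyP fD tf] j jm.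
  have := fD (Ordinal jm); rewrite unfold_in /Q /=.
  by congr (E j _); apply: eq_bigr => i _; rewrite tf// -[j]/(val (Ordinal jm)) bE.
have mpat f : measurable (pat m (b f)) by have [] := prob_pattern m (b f).
have fD : finite_set D by exact: finite_finset.
rewrite e; split; first by apply: fin_bigcup_measurable.
rewrite measure_fin_bigcup//; last first.
  move=> f g _ _ [t [tf tg]]; apply/ffunP => j; apply/ffunP => i.
  by rewrite -!bE -tf// tg.
rewrite (fsbigE (enum (family Q))); last 3 first.
- exact: enum_uniq.
- by move=> f /=; rewrite mem_enum.
- by move=> f; rewrite /D /= mem_enum => ->.
rewrite (eq_bigr (fun f => (\prod_(j < m) \prod_i w j (b f j i))%:E)); last first.
  by move=> f _; have [_] := prob_pattern m (b f).
rewrite big_enum_cond /= sumEFin; congr (_%:E).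
under [RHS]eq_bigr do rewrite -sum_ffun_bin_prob.
rewrite (bigA_distr_big_dep Q (fun j v => \prod_i (if v i then p j else 1 - p j))).
apply: eq_big => [f|f _].
  by rewrite /D; apply/andP/idP => [[]//|h]; split => //; rewrite inE.
by apply: eq_bigr => j _; apply: eq_bigr => i _; rewrite bE.
Qed.

Lemma prob_count1 (j : nat) (E : pred nat) :
  measurable [set t | E (count_ones j t)] /\
  P [set t | E (count_ones j t)] = (bin_prob n (p j) E)%:E.
Proof.
pose E' i : pred nat := if i == j then E else xpredT.
have [mE PE] := prob_counts j.+1 E'.
have e : [set t | forall i, (i < j.+1)%N -> E' i (count_ones i t)] =
    [set t | E (count_ones j t)].
  apply/seteqP; split => t /=.
    by move=> /(_ j (ltnSn j)); rewrite /E' eqxx.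
  by move=> h i _; rewrite /E'; case: eqP => [->|].
rewrite e in mE PE; split=> //; rewrite PE big_ord_recr /= /E' eqxx big1 ?mul1r//.
by move=> i _; rewrite ltn_eqF// bin_probT.
Qed.

(** Counts are discrete: the preimage of any set is an event about one count, covered by
    [prob_count1]. *)
Lemma measurable_fun_count (j : nat) (g : nat -> R) :
  measurable_fun setT (fun t => g (count_ones j t)).
Proof.
move=> _ Y _; rewrite setTI.
have -> : (fun t => g (count_ones j t)) @^-1` Y =
    [set t | (fun k => `[< Y (g k) >]) (count_ones j t)].
  by apply/seteqP; split => t /= /asboolP.
by have [] := prob_count1 j (fun k => `[< Y (g k) >]).
Qed.

Lemma measurable_fun_sup_counts (g : nat -> nat -> R) :
  measurable_fun setT (fun t => sup_seq (fun j => g j (count_ones j t))).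
Proof.
have -> : (fun t => sup_seq (fun j => g j (count_ones j t))) =
    (fun t => esups ((fun j t => (g j (count_ones j t))%:E) ^~ t) 0%N).
  apply/funext => t; rewrite /esups /= /sup_seq; congr ereal_sup.
  by apply/seteqP; split => [_ [j _ <-]|_ [j _ <-]]; exists j.
apply: measurable_fun_esups => j; apply/measurable_EFinP.
exact: measurable_fun_count.
Qed.

End Counts.

(** * The supremum of the deviations *)

(** Follows from 1 - exp (- s) >= s / (1 + s). *)
Lemma expRN_le_sub_half (R : realType) (s : R) : 0 <= s ->
  Num.min 1 s / 2 <= 1 - expR (- s).
Proof.
move=> s0; have h : expR (- s) <= (1 + s)^-1.
  by rewrite expRN lef_pV2 ?posrE ?expR_gt0 ?expR_ge1Dx//; lra.
suff : Num.min 1 s / 2 <= 1 - (1 + s)^-1 by lra.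
have -> : 1 - (1 + s)^-1 = s / (1 + s) by field; lra.
rewrite ler_pdivlMr; last lra.
by case: (leP 1 s) => s1; nra.
Qed.

Lemma bernoulli_ineq (R : realType) (p : R) n : 0 <= p <= 1 ->
  1 - n%:R * p <= (1 - p) ^+ n.
Proof.
move=> p01; elim: n => [|n IH]; first by rewrite mul0r subr0 expr0.
have p1 : 0 <= 1 - p by lra.
rewrite exprS; apply: le_trans (ler_wpM2l p1 IH).
have : 0 <= n%:R * p * p by rewrite !mulr_ge0//; lra.
by rewrite -natr1; lra.
Qed.

Lemma bin_prob_eq0 (R : realType) n (p : R) :
  bin_prob n p (pred1 0%N) = (1 - p) ^+ n.
Proof.
rewrite /bin_prob (big_pred1 ord0) => [|k]; last by rewrite /= -[RHS]val_eqE.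
by rewrite binomial_pmfE bin0 subn0 expr0 !mul1r.
Qed.

Lemma bin_prob_ge1_le (R : realType) n (p : R) : 0 <= p <= 1 ->
  bin_prob n p (fun k => (0 < k)%N) <= n%:R * p.
Proof.
move=> p01; have := bernoulli_ineq n p01.
rewrite -bin_prob_eq0; have := bin_probC n p (pred1 0%N).
suff : bin_prob n p (fun k => (0 < k)%N) <= bin_prob n p (predC (pred1 0%N)) by lra.
by apply: le_bin_prob => // k; rewrite !unfold_in lt0n.
Qed.

(** Term by term, the mass at i + 2 is at most n (n - 1) p^2 / 2 times the mass at i of the binomial
    law with n - 2 trials. *)
Lemma bin_prob_ge2_le (R : realType) n (p : R) : 0 <= p <= 1 ->
  bin_prob n p (fun k => (1 < k)%N) <= (n%:R * p) ^+ 2 / 2.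
Proof.
move=> p01; case: n => [|[|n]].
- rewrite bin_prob0; first by rewrite mul0r expr0n/= mul0r.
  by case.
- rewrite bin_prob0; first by rewrite divr_ge0 ?sqr_ge0.
  by move=> [|[]].
rewrite /bin_prob big_mkcond big_ord_recl big_ord_recl /= !add0r.
pose c : R := n.+2%:R * n.+1%:R / 2 * p ^+ 2.
apply: (@le_trans _ _ (\sum_(i < n.+1) c * binomial_pmf n p i)).
  apply: ler_sum => i _; rewrite !binomial_pmfE /bump /= !add1n !subSS !exprS.
  have h : i.+2%:R * i.+1%:R * 'C(n.+2, i.+2)%:R = n.+2%:R * n.+1%:R * 'C(n, i)%:R :> R.
    rewrite -!natrM; congr (_%:R); rewrite mulnAC -mul_bin_diag /=.
    by rewrite -mulnA [('C(_, _) * _)%N]mulnC -mul_bin_diag /= mulnA.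
  have h2 : 2 * 'C(n.+2, i.+2)%:R <= n.+2%:R * n.+1%:R * 'C(n, i)%:R :> R.
    by rewrite -h -!natrM ler_nat leq_mul2r (@leq_mul 2 1) ?orbT.
  have q0 : 0 <= p ^+ i * (1 - p) ^+ (n - i) by rewrite mulr_ge0 ?exprn_ge0//; lra.
  have q2 : 0 <= p ^+ 2 * (p ^+ i * (1 - p) ^+ (n - i)) by rewrite mulr_ge0 ?sqr_ge0.
  have := ler_wpM2r q2 h2; rewrite /c; lra.
rewrite -big_distrr /= -/(bin_prob n p predT) bin_probT mulr1 /c exprMn mulrAC.
rewrite ler_pM2r// ler_wpM2r ?sqr_ge0// expr2 ler_wpM2l//.
by rewrite ler_nat.
Qed.

(** Telescoping through 1/a^2 <= 2 (1/a - 1/(a + 1)); the induction runs on the sharper bound 2 (1 -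
    1/(N + 1)). *)
Lemma sum_inv_sqr_le (R : realType) N :
  \sum_(0 <= j < N) j.+1%:R ^- 2 <= 2 :> R.
Proof.
suff : \sum_(0 <= j < N) j.+1%:R ^- 2 <= 2 * (1 - N.+1%:R^-1) :> R.
  by move=> /le_trans; apply; rewrite ler_piMr// gerBl.
elim: N => [|N IH]; first by rewrite big_nil invr1 subrr mulr0.
rewrite big_nat_recr //=; apply: (le_trans (lerD IH (lexx _))).
have a0 : 1 <= N.+1%:R :> R by rewrite ler1n.
rewrite -[N.+2%:R]natr1; set a := N.+1%:R in a0 *.
have : 0 <= 2 / (a * (a + 1)) - a ^- 2.
  have -> : 2 / (a * (a + 1)) - a ^- 2 = (a - 1) / (a ^+ 2 * (a + 1)) by field; lra.
  by rewrite divr_ge0 ?mulr_ge0 ?sqr_ge0//; lra.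
have -> : 2 / (a * (a + 1)) = 2 * (a^-1 - (a + 1)^-1) by field; lra.
set v := (a + 1)^-1; set u := a^-1; set w := a ^- 2; lra.
Qed.

Lemma nneseries_le_bound (R : realType) (f : nat -> R) (B : R) :
  (forall j, 0 <= f j) -> (forall N, \sum_(0 <= j < N) f j <= B) ->
  (\sum_(0 <= j <oo) (f j)%:E <= B%:E)%E.
Proof.
move=> f0 fB; apply: lime_le.
  by apply: is_cvg_nneseries => j _ _; rewrite lee_fin.
by near=> N; rewrite sumEFin lee_fin.
Unshelve. all: by end_near.
Qed.

Lemma sup_seq_le (R : realType) (u : nat -> R) (x : \bar R) :
  (sup_seq u <= x)%E <-> forall j, ((u j)%:E <= x)%E.
Proof.
split=> [h j|h]; last by apply: ge_ereal_sup => _ [j _ <-].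
by apply: le_trans h; apply: ereal_sup_ubound; exists j.
Qed.

Lemma lt_sup_seq (R : realType) (u : nat -> R) (x : R) :
  (x%:E < sup_seq u)%E -> exists j, x < u j.
Proof.
move=> h; apply: contrapT => /forallNP nu; move: h; apply/negP; rewrite -leNgt.
by apply/sup_seq_le => j; rewrite lee_fin leNgt; apply/negP/nu.
Qed.

Lemma sup_seq_fin (R : realType) (u : nat -> R) : (forall j, 0 <= u j <= 1) ->
  exists s, [/\ sup_seq u = s%:E, 0 <= s & forall j, u j <= s].
Proof.
move=> u01; have s1 : (sup_seq u <= 1%:E)%E.
  by apply/sup_seq_le => j; rewrite lee_fin; case/andP: (u01 j).
have us : forall j, ((u j)%:E <= sup_seq u)%E by apply/sup_seq_le.
have s0 : (0%:E <= sup_seq u)%E.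
  by apply: le_trans (us 0%N); rewrite lee_fin; case/andP: (u01 0%N).
have fs : sup_seq u \is a fin_num.
  by rewrite ge0_fin_numE//; apply: le_lt_trans s1 (ltry _).
exists (fine (sup_seq u)); rewrite fineK//; split => //.
  by rewrite -lee_fin fineK.
by move=> j; rewrite -lee_fin fineK.
Qed.

(** * Coordinatewise bounds combined into bounds for the suprema *)

Section Bounds.
Variables (R : realType) (n : nat) (gamma : R) (p : nat -> R).
Variables (d : measure_display) (T : measurableType d) (P : probability T R).
Variables (mu : probability binseq R) (X : 'I_n -> {RV P >-> binseq}).
Hypotheses (n0 : (0 < n)%N) (gamma2 : 0 < gamma < 2^-1).
Hypothesis p2 : forall j, 0 <= p j <= 2^-1.
Hypothesis pdec : forall j, p j.+1 <= p j.
Hypothesis hmu : product_bernoulli p mu.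
Hypothesis hX : iid_sample mu X.

Let p01 j : 0 <= p j <= 1. Proof. by have := p2 j; lra. Qed.
Let n0R : 0 < n%:R :> R. Proof. by rewrite ltr0n. Qed.

Lemma emp_meanE t j : emp_mean R X t j = (count_ones X j t)%:R / n%:R.
Proof. by rewrite /emp_mean /count_ones natr_sum. Qed.

Lemma sup_emp_meanE (g : nat -> R -> R) t :
  sup_seq (fun j => g j (emp_mean R X t j)) =
  sup_seq (fun j => g j ((count_ones X j t)%:R / n%:R)).
Proof. by congr sup_seq; apply/funext => j; rewrite emp_meanE. Qed.

Let devE t := sup_emp_meanE (fun j x => `|x - p j|) t.
Let phatE t := sup_emp_meanE (fun=> id) t.

Lemma measurable_sup_ge (g : nat -> nat -> R) (x : \bar R) :
  measurable [set t | (x <= sup_seq (fun j => g j (count_ones X j t)))%E].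
Proof.
have := measurable_fun_sup_counts p01 hmu hX g.
by move=> /(emeasurable_fun_c_infty measurableT)/(_ x); rewrite setTI.
Qed.

Lemma measurable_sup_le (g : nat -> nat -> R) (x : \bar R) :
  measurable [set t | (sup_seq (fun j => g j (count_ones X j t)) <= x)%E].
Proof.
have := measurable_fun_sup_counts p01 hmu hX g.
by move=> /(emeasurable_fun_infty_c measurableT)/(_ x); rewrite setTI.
Qed.

Lemma prob_le_sum_bin_prob (A : set T) (E : nat -> pred nat) (B : R) :
  measurable A -> (forall t, A t -> exists j, E j (count_ones X j t)) ->
  (forall N, \sum_(0 <= j < N) bin_prob n (p j) (E j) <= B) ->
  (P A <= B%:E)%E.
Proof.
move=> mA AE EB.
have mE j := (prob_count1 p01 hmu hX j (E j)).1.
have : A `<=` \bigcup_j [set t | E j (count_ones X j t)].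
  by move=> t /AE[j Ej]; exists j.
move=> /(measure_sigma_subadditive P mE mA) /le_trans; apply.
rewrite (eq_eseriesr (fun j _ => (prob_count1 p01 hmu hX j (E j)).2)).
by apply: nneseries_le_bound => // j; exact: bin_prob_ge0.
Qed.

Lemma sum_le_inv_sqr (c : R) (f : nat -> R) : 0 <= c ->
  (forall j, f j <= c * j.+1%:R ^- 2) -> forall N, \sum_(0 <= j < N) f j <= 2 * c.
Proof.
move=> c0 fc N; apply: (@le_trans _ _ (\sum_(0 <= j < N) c * j.+1%:R ^- 2)).
  by apply: ler_sum => j _.
by rewrite -big_distrr /= mulrC ler_wpM2r// sum_inv_sqr_le.
Qed.

(** A union bound whose terms 2 (J + 1)^-3 are at most 2 gamma^3 / j^2 in mathematical indices;
    their sum is at most 4 gamma^3 <= gamma. A positive parameter makes the supremum [s]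
    positive. *)
Lemma prob_dev_upper : (exists j, 0 < p j) ->
  (P [set t | (40%:E * sup_seq (fun j => phi (j.+1%:R / gamma) (p j) n) <=
     sup_seq (fun j => `|emp_mean R X t j - p j|%R))%E] <= gamma%:E)%E.
Proof.
move=> [j0 pj0]; have [g0 g2] := andP gamma2.
have J2 j : 2 <= j.+1%:R / gamma :> R.
  by rewrite ler_pdivlMr//; have : 1 <= j.+1%:R :> R; [rewrite ler1n|lra].
have J0 j : 0 < j.+1%:R / gamma :> R by have := J2 j; lra.
have u01 j : 0 <= phi (j.+1%:R / gamma) (p j) n <= 1.
  by rewrite phi_ge0//= phi_le1.
have [s [-> s0 us]] := sup_seq_fin u01.
have {}s0 : 0 < s.
  apply: lt_le_trans (us j0); apply: phi_gt0 => //.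
  by have := p2 j0; rewrite pj0; lra.
under eq_set => t do rewrite devE.
apply: (@prob_le_sum_bin_prob _ (fun j k => 20 * s <= `|k%:R / n%:R - p j|)).
- exact: (measurable_sup_ge (fun j k => `|k%:R / n%:R - p j|)).
- move=> t /= h.
  (* The supremum need not be attained; the gap between 40 s and 20 s yields a coordinate that
     deviates by 20 s. *)
  have : ((20 * s)%:E <
      sup_seq (fun j => `|(count_ones X j t)%:R / n%:R - p j|%R))%E.
    by apply: lt_le_trans h; rewrite -EFinM lte_fin; lra.
  by move=> /lt_sup_seq[j /ltW]; exists j.
have c0 : 0 <= 2 * gamma ^+ 3 by rewrite mulr_ge0// exprn_ge0// ltW.
move=> N; apply: (le_trans (sum_le_inv_sqr c0 _ N)); last first.
  have : gamma * gamma <= 2^-1 * 2^-1 by apply: ler_pM; lra.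
  by move=> /(ler_wpM2l (ltW g0)); rewrite exprS expr2; lra.
move=> j; have J1 : 1 <= j.+1%:R / gamma by have := J2 j; lra.
apply: (le_trans (bin_prob_dev_phi_le n0 (p2 j) J1 s0 (us j))).
rewrite -mulrA ler_pM2l// expRN expRM_natl lnK ?posrE; last by have := J0 j; lra.
apply: (@le_trans _ _ ((j.+1%:R / gamma) ^- 3)).
  rewrite lef_pV2 ?posrE ?exprn_gt0//; last by have := J0 j; lra.
  by apply: lerXn2r; rewrite ?nnegrE; have := J0 j; lra.
rewrite -exprVn invf_div expr_div_n ler_pM2l ?exprn_gt0//.
rewrite lef_pV2 ?posrE ?exprn_gt0//.
by apply: ler_weXn2l; rewrite ?ler1n.
Qed.

Let p_le i j : (i <= j)%N -> p j <= p i.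
Proof.
move=> /subnK <-; elim: (j - i)%N => [//|k IH]; rewrite addSn.
exact: le_trans (pdec _) IH.
Qed.

Lemma prob_dev_lower :
  (P [set t | (Order.max (sup_seq (fun j => `|emp_mean R X t j - p j|%R)) (n%:R^-1)%:E
     <= (100^-1 / 100 / 2)%:E *
        sup_seq (fun j => phi (j.+1%:R / ln gamma^-1) (p j) n))%E] <= gamma%:E)%E.
Proof.
have [g0 g2] := andP gamma2.
have lg : 0 < ln gamma^-1 by apply: ln_inv_gt0; lra.
have J0 j : 0 < j.+1%:R / ln gamma^-1 by rewrite divr_gt0.
have u01 j : 0 <= phi (j.+1%:R / ln gamma^-1) (p j) n <= 1.
  by rewrite phi_ge0//= phi_le1.
have [s [sE s0 us]] := sup_seq_fin u01; rewrite sE -EFinM.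
set a := 100^-1 / 100 / 2 * s.
(* If [a < 1/n] the event is empty, because the maximum is at least 1/n. *)
have [an|na] := ltP a n%:R^-1.
  rewrite (_ : [set t | _] = set0) ?measure0 ?lee_fin ?ltW//.
  apply/seteqP; split => // t /=; rewrite ge_max => /andP[_].
  by rewrite lee_fin leNgt an.
have {}s0 : 0 < s.
  have : 0 < a by apply: lt_le_trans na; rewrite invr_gt0.
  by rewrite /a; lra.
(* An almost maximal index; the loss of a factor 2 is the extra 1/2 in the constant. *)
have [j sj] : exists j, s / 2 < phi (j.+1%:R / ln gamma^-1) (p j) n.
  by apply: lt_sup_seq; rewrite sE lte_fin; lra.
set J := j.+1%:R / _ in sj.
have aJ : a <= 100^-1 / 100 * phi J (p j) n by rewrite /a; lra.
pose E i : pred nat := fun k => `|k%:R / n%:R - p i| <= 100^-1 / 100 * phi J (p j) n.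
have [mE PE] := prob_counts p01 hmu hX j.+1 E.
apply: (@le_trans _ _ (P [set t | forall i, (i < j.+1)%N -> E i (count_ones X i t)])).
  apply: le_measure; rewrite ?inE//.
    rewrite (_ : [set t | _] = [set t |
        (sup_seq (fun j => `|(count_ones X j t)%:R / n%:R - p j|%R) <= a%:E)%E]).
      exact: (measurable_sup_le (fun j k => `|k%:R / n%:R - p j|)).
    by apply/seteqP; split => t /=; rewrite ge_max lee_fin na andbT devE.
  move=> t /=; rewrite ge_max => /andP[/sup_seq_le h _] i _.
  by have := h i; rewrite lee_fin emp_meanE => /le_trans; apply.
rewrite PE lee_fin.
apply: (@le_trans _ _ (\prod_(i < j.+1) expR (- J^-1))).
  apply: ler_prod => i _; rewrite bin_prob_ge0//=.
  apply: bin_prob_window_phi_le => //.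
  - by rewrite p_le ?andbT; [case/andP: (p2 j)|rewrite -ltnS].
  - by case/andP: (p2 i).
  - exact: J0.
  - exact: le_trans aJ.
rewrite prodr_const card_ord -expRM_natl.
(* The number of coordinates is exactly J ln (1/gamma), so the product is gamma. *)
have -> : j.+1%:R * - J^-1 = ln gamma.
  rewrite /J invf_div lnV ?posrE// mulNr opprK mulrCA divff ?mulr1//.
by rewrite lnK.
Qed.

(** * Small parameters: all counts are at most 1 with high probability *)

Hypothesis p_small : forall j, p j <= gamma / (2 * n%:R * j.+1%:R).

Let np_small j : n%:R * p j <= gamma / 2 / j.+1%:R.
Proof.
have := p_small j; rewrite -(ler_pM2l n0R) => /le_trans; apply.
rewrite le_eqVlt; apply/orP; left; apply/eqP; field.
by rewrite nat1r !pnatr_eq0 /= -lt0n.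
Qed.

Let np0 j : 0 <= n%:R * p j.
Proof. by rewrite mulr_ge0//; case/andP: (p2 j). Qed.

Let np_half j : n%:R * p j <= gamma / 2.
Proof.
have [g0 g2] := andP gamma2.
apply: (le_trans (np_small j)); rewrite ler_pdivrMr// ler_peMr ?ler1n//; lra.
Qed.

Lemma sum_ge2_le N :
  \sum_(0 <= j < N) bin_prob n (p j) (fun k => (1 < k)%N) <= gamma ^+ 2 / 4.
Proof.
have [g0 g2] := andP gamma2.
have c0 : 0 <= gamma ^+ 2 / 8 by rewrite divr_ge0 ?sqr_ge0.
apply: (le_trans (sum_le_inv_sqr c0 _ N)); last lra.
move=> j; apply: (le_trans (bin_prob_ge2_le n (p01 j))).
have : (n%:R * p j) ^+ 2 <= (gamma / 2 / j.+1%:R) ^+ 2.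
  by apply: lerXn2r; rewrite ?nnegrE// !divr_ge0// ltW.
have -> : (gamma / 2 / j.+1%:R) ^+ 2 = gamma ^+ 2 / 4 * j.+1%:R ^- 2.
  by field; rewrite nat1r pnatr_eq0.
set w := _ ^- 2; lra.
Qed.

Let count_le1 t : (forall j, ~ (1 < count_ones X j t)%N) ->
  (sup_seq (emp_mean R X t) <= (n%:R^-1)%:E)%E.
Proof.
move=> h; apply/sup_seq_le => j; rewrite lee_fin emp_meanE.
rewrite ler_pdivrMr// mulVf ?gt_eqF// (ler_nat _ _ 1) leqNgt; exact/negP/h.
Qed.

Lemma prob_two_le :
  (P [set t | ((2 / n%:R)%:E <= sup_seq (emp_mean R X t))%E] <= gamma%:E)%E.
Proof.
have [g0 g2] := andP gamma2.
apply: (@prob_le_sum_bin_prob _ (fun _ k => (1 < k)%N)).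
- have := measurable_sup_ge (fun j k => k%:R / n%:R) (2 / n%:R)%:E.
  by congr measurable; apply/seteqP; split => t /=; rewrite phatE.
- move=> t /= h; apply: contrapT => /forallNP /count_le1 /(le_trans h).
  by rewrite lee_fin ler_pdivrMr// mulVf ?gt_eqF// (ler_nat R 2 1).
- move=> N; apply: (le_trans (sum_ge2_le N)).
  rewrite expr2; nra.
Qed.

Let measurable_sup_eq : measurable [set t | sup_seq (emp_mean R X t) = (n%:R^-1)%:E].
Proof.
have := measurableI _ _
  (measurable_sup_ge (fun j k => k%:R / n%:R) (n%:R^-1)%:E)
  (measurable_sup_le (fun j k => k%:R / n%:R) (n%:R^-1)%:E).
congr measurable; apply/seteqP; split => t /=; rewrite phatE.
  by move=> [h1 h2]; apply/eqP; rewrite eq_le h1 h2.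
by move=> ->.
Qed.

Let sumE : (n%:R%:E * \sum_(0 <= j <oo) (p j)%:E = \sum_(0 <= j <oo) (n%:R * p j)%:E)%E.
Proof.
rewrite (eq_eseriesr (fun j _ => EFinM n%:R (p j))) nneseriesZl// => j _.
by rewrite lee_fin; case/andP: (p2 j).
Qed.

Let U1 : set T := \bigcup_j [set t | (0 < count_ones X j t)%N].
Let U2 : set T := \bigcup_j [set t | (1 < count_ones X j t)%N].

Let mU1 : measurable U1.
Proof.
apply: bigcup_measurable => j _.
exact: (prob_count1 p01 hmu hX j (fun k => (0 < k)%N)).1.
Qed.

Let mU2 : measurable U2.
Proof.
apply: bigcup_measurable => j _.
exact: (prob_count1 p01 hmu hX j (fun k => (1 < k)%N)).1.
Qed.

Lemma prob_one_upper :
  (P [set t | sup_seq (emp_mean R X t) = (n%:R^-1)%:E] <=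
    Order.min 1 (n%:R%:E * \sum_(0 <= j <oo) (p j)%:E))%E.
Proof.
rewrite le_min probability_le1//= sumE.
have AE : [set t | sup_seq (emp_mean R X t) = (n%:R^-1)%:E] `<=` U1.
  move=> t /= h; apply: contrapT => nU.
  have : (sup_seq (emp_mean R X t) <= 0%:E)%E.
    apply/sup_seq_le => j; rewrite lee_fin emp_meanE.
    have -> : count_ones X j t = 0%N; last by rewrite mul0r.
    by apply/eqP; rewrite -leqn0 leqNgt; apply/negP => hj; apply: nU; exists j.
  by rewrite h lee_fin leNgt invr_gt0 n0R.
have mE j := (prob_count1 p01 hmu hX j (fun k => (0 < k)%N)).1.
apply: (le_trans (measure_sigma_subadditive P mE measurable_sup_eq AE)).
apply: lee_nneseries => // j _.
apply: (@le_trans _ _ (bin_prob n (p j) (fun k => (0 < k)%N))%:E).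
  by have [_ <-] := prob_count1 p01 hmu hX j (fun k => (0 < k)%N).
by rewrite lee_fin bin_prob_ge1_le.
Qed.

(** By independence the first [m] counts all vanish with probability equal to the product of the (1
    - p j)^n. *)
Let U1_ge m : ((1 - expR (- \sum_(0 <= j < m) n%:R * p j)%R)%:E <= P U1)%E.
Proof.
have [mZ PZ] := prob_counts p01 hmu hX m (fun _ => pred1 0%N).
apply: (@le_trans _ _ (P (~` [set t | forall j, (j < m)%N -> pred1 0%N (count_ones X j t)]))).
  rewrite probability_setC// PZ -EFinB lee_fin lerD2l lerN2.
  rewrite -sumrN expR_sum big_mkord; apply: ler_prod => j _.
  rewrite bin_prob_ge0//= bin_prob_eq0 -mulrN expRM_natl.
  have pj := p01 j.
  apply: lerXn2r; rewrite ?nnegrE ?expR_ge0//; first lra.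
  exact: expR_ge1Dx.
apply: le_measure; rewrite ?inE//; first exact: measurableC.
move=> t /= /existsNP[j /not_implyP[_ /negP]]; rewrite -lt0n => h.
by exists j.
Qed.

(** A positive count forces the supremum to be 1/n unless some count exceeds 1, so P U1 <= P A + P
    U2. Either P A >= 1/4 already, or P U2 is at most a quarter of P U1. *)
Lemma prob_one_lower :
  (4^-1%:E * Order.min 1 (n%:R%:E * \sum_(0 <= j <oo) (p j)%:E) <=
    P [set t | sup_seq (emp_mean R X t) = (n%:R^-1)%:E])%E.
Proof.
have [g0 g2] := andP gamma2.
set A := [set t | _].
have mA : measurable A by exact: measurable_sup_eq.
have fP B : measurable B -> P B \is a fin_num by move=> mB; exact: fin_num_measure.
set z := fine (P A); set x := fine (P U1); set y := fine (P U2).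
have zE : P A = z%:E by rewrite /z fineK ?fP.
have xE : P U1 = x%:E by rewrite /x fineK ?fP.
have yE : P U2 = y%:E by rewrite /y fineK ?fP.
have z0 : 0 <= z by rewrite -lee_fin -zE.
have xyz : x <= z + y.
  rewrite -lee_fin EFinD -xE -zE -yE.
  apply: le_trans (measureU2 _ mA mU2).
  apply: le_measure; rewrite ?inE//; first exact: measurableU.
  move=> t [j _ /= tj]; have [tU2|nU2] := pselect (U2 t); first by right.
  left; apply/eqP; rewrite eq_le; apply/andP; split.
    by apply: count_le1 => i ti; apply: nU2; exists i.
  apply: (@le_trans _ _ (emp_mean R X t j)%:E); last exact: ((sup_seq_le _ _).1 (lexx _) j).
  by rewrite lee_fin emp_meanE ler_peMl ?invr_ge0// ler1n.
have y16 : y <= 16^-1.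
  rewrite -lee_fin -yE; apply: (@prob_le_sum_bin_prob _ (fun _ k => (1 < k)%N)) => //.
    by move=> t [j _ tj]; exists j.
  move=> N; apply: (le_trans (sum_ge2_le N)); nra.
have [z4|z4] := leP 4^-1 z.
  rewrite zE -[leRHS]mul1e; apply: (@le_trans _ _ (4^-1%:E * 1)%E).
    by rewrite lee_wpmul2l ?lee_fin// ge_min lexx.
  by rewrite mule1 mul1e lee_fin.
(* Here x <= z + y < 1/2, so the minimum in [expRN_le_sub_half] is not 1. *)
have sx m : \sum_(0 <= j < m) n%:R * p j <= 2 * x.
  have s0 : 0 <= \sum_(0 <= j < m) n%:R * p j by apply: sumr_ge0.
  have := U1_ge m; rewrite xE lee_fin; have := expRN_le_sub_half s0.
  by rewrite /Num.min; case: ifP; lra.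
(* As np_j <= 1/4, each term (np_j)^2 / 2 is at most np_j / 8. *)
have yx : y <= x / 4.
  rewrite -lee_fin -yE; apply: (@prob_le_sum_bin_prob _ (fun _ k => (1 < k)%N)) => //.
    by move=> t [j _ tj]; exists j.
  move=> N; apply: (@le_trans _ _ (\sum_(0 <= j < N) (n%:R * p j) * 8^-1)).
    apply: ler_sum => j _; apply: (le_trans (bin_prob_ge2_le n (p01 j))).
    have h : n%:R * p j <= 4^-1 by have := np_half j; lra.
    have := ler_wpM2l (np0 j) h; rewrite expr2; lra.
  rewrite -big_distrl /=; have := sx N; lra.
(* Now z >= x - y >= 3x/4, hence 2x <= 4z. *)
have sB : (n%:R%:E * \sum_(0 <= j <oo) (p j)%:E <= (4 * z)%:E)%E.
  rewrite sumE; apply: nneseries_le_bound => // N; have := sx N; lra.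
rewrite zE; apply: (@le_trans _ _ (4^-1%:E * (4 * z)%:E)%E).
  by rewrite lee_wpmul2l ?lee_fin// ge_min sB orbT.
by rewrite -EFinM lee_fin; lra.
Qed.

End Bounds.

Unset Implicit Arguments.

Theorem proposition9 (R : realType) :
  exists a1 a2 c C : R,
    [/\ 0 < a1, 0 < a2, 0 < c & c <= C] /\
    forall (n : nat) (gamma : R) (p : nat -> R)
      (d : measure_display) (T : measurableType d) (P : probability T R)
      (mu : probability binseq R) (X : 'I_n -> {RV P >-> binseq}),
      (1 <= n)%N ->
      0 < gamma < 2^-1 ->
      (forall j, 0 <= p j <= 2^-1) ->
      (forall j, p j.+1 <= p j) ->
      product_bernoulli p mu ->
      iid_sample mu X ->
      let phat (t : T) : nat -> R := emp_mean R X t in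
      let dev (t : T) : \bar R := sup_seq (fun j => `|phat t j - p j|) in
      ((exists j, gamma / (2 * n%:R * j.+1%:R) <= p j) ->
        (P [set t | a1%:E * sup_seq (fun j => phi (j.+1%:R / gamma) (p j) n)
                      <= dev t] <= gamma%:E)%E /\
        (P [set t | Order.max (dev t) (n%:R^-1)%:E
                      <= a2%:E * sup_seq (fun j =>
                           phi (j.+1%:R / ln (gamma^-1)) (p j) n)]
           <= gamma%:E)%E) /\
      ((forall j, p j <= gamma / (2 * n%:R * j.+1%:R)) ->
        (P [set t | (2 / n%:R)%:E <= sup_seq (phat t)] <= gamma%:E)%E /\
        (let A := P [set t | sup_seq (phat t) = (n%:R^-1)%:E] in
         let B := Order.min 1 (n%:R%:E * \sum_(0 <= j <oo) (p j)%:E) in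
         c%:E * B <= A /\ A <= C%:E * B)%E).
Proof.
(* 40 is twice the Chernoff deviation level 20, and the second constant is half the small-ball
   constant 1/10^4. *)
exists 40, (100^-1 / 100 / 2), 4^-1, 1; split; first by split; lra.
move=> n gamma p d T P mu X n0 gamma2 p2 pdec hmu hX phat dev; split.
  move=> [j pj]; split; last exact: (prob_dev_lower n0 gamma2 p2 pdec hmu hX).
  apply: (prob_dev_upper n0 gamma2 p2 hmu hX); exists j; apply: lt_le_trans pj.
  by rewrite divr_gt0 ?mulr_gt0 ?ltr0n//; case/andP: gamma2.
move=> psmall; split; first exact: (prob_two_le n0 gamma2 p2 hmu hX psmall).
split; first exact: (prob_one_lower n0 gamma2 p2 hmu hX psmall).
by rewrite mul1e; exact: (prob_one_upper n0 p2 hmu hX).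
Qed.
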